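(* Given a set of $n$ points in the plane, $k\in\Theta(n)$, and $\varepsilon>0$, a $(1+\varepsilon)$-approximation of the smallest axis-aligned $k$-enclosing square can be computed in time $\mathcal{O}\left(n+\frac{1}{\varepsilon^2}\log\frac{1}{\varepsilon}\right)$.
   Context: The smallest axis-aligned $k$-enclosing square of a finite planar point set is an axis-parallel square of minimum side length that encloses (at least) $k$ of the points. A $(1+\varepsilon)$-approximation is an axis-parallel square that encloses at least $k$ of the points and whose side length is at most $(1+\varepsilon)$ times the minimum side length. *)

(* Defs.v *)
(* MathComp / MathComp-Analysis. *)
From HB Require Import structures.
From mathcomp Require Import all_boot all_order all_algebra.
From mathcomp Require Import reals exp.

Set Implicit Arguments.
Unset Strict Implicit.
Unset Printing Implicit Defensive.

Import Order.TTheory GRing.Theory Num.Theory.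

Local Open Scope ring_scope.

(** * Smallest k-enclosing squares *)

(* The axis-parallel square [a, a + l] x [b, b + l], (a, b) = corner, l = side. *)
Record square (R : realType) := Square { corner : R * R; side : R }.

Definition encloses (R : realType) (Q : square R) (p : R * R) : bool :=
  ((corner Q).1 <= p.1 <= (corner Q).1 + side Q) &&
  ((corner Q).2 <= p.2 <= (corner Q).2 + side Q).

(* Degenerate squares (side 0) are admitted: they are what makes the minimum
   exist when k = 1.  The point set is a duplicate-free sequence, so [count]
   is the number of its points lying in Q. *)
Definition k_enclosing (R : realType) (pts : seq (R * R)) (k : nat)
    (Q : square R) : Prop :=
  0 <= side Q /\ (k <= count (encloses Q) pts)%N.

Definition smallest_k_enclosing (R : realType) (pts : seq (R * R)) (k : nat)
    (Q : square R) : Prop :=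
  k_enclosing pts k Q /\ forall Q', k_enclosing pts k Q' -> side Q <= side Q'.

Definition approx_smallest (R : realType) (pts : seq (R * R)) (k : nat)
    (eps : R) (Q : square R) : Prop :=
  k_enclosing pts k Q /\
  exists2 Qmin, smallest_k_enclosing pts k Qmin
              & side Q <= (1 + eps) * side Qmin.

(** * A real RAM with floor

   Memory consists of integer arrays and real arrays, both named by naturals
   and indexed by naturals; a scalar variable is cell 0 of an array.  A program
   mentions finitely many arrays, and contains no real constant.

   Integers are machine words: an integer operation, and in particular the
   floor of a real, is defined only if the absolute value of its result is at
   most the word bound [W].  So neither the floor function nor integer
   arithmetic can be used to pack unbounded information into one cell, and only
   addresses up to W are usable.  Undefined operations (word overflow, division
   by zero, negative address) have value [None] and block the execution. *)

Inductive iexp :=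
| IConst of int
| IGet of nat & iexp
| IAdd of iexp & iexp
| ISub of iexp & iexp
| IMul of iexp & iexp
| IFloor of rexp
with rexp :=
| ROfInt of iexp
| RGet of nat & iexp
| RAdd of rexp & rexp
| RSub of rexp & rexp
| RMul of rexp & rexp
| RDiv of rexp & rexp.

Inductive bexp :=
| BIntLe of iexp & iexp
| BRealLe of rexp & rexp
| BNot of bexp
| BAnd of bexp & bexp.

Inductive cmd :=
| Skip
| ISet of nat & iexp & iexp   (* ISet a i e is the assignment a[i] := e *)
| RSet of nat & iexp & rexp
| Seq of cmd & cmd
| If of bexp & cmd & cmd
| While of bexp & cmd.

Record store (R : realType) :=
  Store { ints : nat -> nat -> int; reals : nat -> nat -> R }.

Definition upd (T : Type) (m : nat -> nat -> T) (a i : nat) (v : T) :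
    nat -> nat -> T :=
  fun b j => if (b == a) && (j == i) then v else m b j.

Definition word (W : nat) (z : int) : option int :=
  if (`|z| <= W)%N then Some z else None.

Definition address (z : int) : option nat :=
  if z is Posz i then Some i else None.

Definition lift2 (A B : Type) (f : A -> A -> option B) (x y : option A) :
    option B :=
  obind (fun u => obind (f u) y) x.

Fixpoint ieval (R : realType) (W : nat) (s : store R) (e : iexp) : option int :=
  match e with
  | IConst z => Some z
  | IGet a e => omap (ints s a) (obind address (ieval W s e))
  | IAdd e f => lift2 (fun u v => word W (u + v)) (ieval W s e) (ieval W s f)
  | ISub e f => lift2 (fun u v => word W (u - v)) (ieval W s e) (ieval W s f)
  | IMul e f => lift2 (fun u v => word W (u * v)) (ieval W s e) (ieval W s f)
  | IFloor e => obind (fun x => word W (Num.floor x)) (reval W s e)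
  end
with reval (R : realType) (W : nat) (s : store R) (e : rexp) : option R :=
  match e with
  | ROfInt e => omap (fun z => z%:~R) (ieval W s e)
  | RGet a e => omap (reals s a) (obind address (ieval W s e))
  | RAdd e f => lift2 (fun x y => Some (x + y)) (reval W s e) (reval W s f)
  | RSub e f => lift2 (fun x y => Some (x - y)) (reval W s e) (reval W s f)
  | RMul e f => lift2 (fun x y => Some (x * y)) (reval W s e) (reval W s f)
  | RDiv e f => lift2 (fun x y => if y == 0 then None else Some (x / y))
                  (reval W s e) (reval W s f)
  end.

Fixpoint beval (R : realType) (W : nat) (s : store R) (b : bexp) : option bool :=
  match b with
  | BIntLe e f => lift2 (fun u v => Some (u <= v)) (ieval W s e) (ieval W s f)
  | BRealLe e f => lift2 (fun x y => Some (x <= y)) (reval W s e) (reval W s f)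
  | BNot b => omap negb (beval W s b)
  | BAnd b c => lift2 (fun u v => Some (u && v)) (beval W s b) (beval W s c)
  end.

(* [exec W c s t s']: with word bound W, started in s, the program c halts in
   s' after t steps.  A step is an assignment or the evaluation of a test; the
   number of elementary operations in one step is bounded by the size of the
   program text, hence is a constant.  The relation is deterministic. *)
Inductive exec (R : realType) (W : nat) :
    cmd -> store R -> nat -> store R -> Prop :=
| ExecSkip s : exec W Skip s 1 s
| ExecISet s a e f i z :
    obind address (ieval W s e) = Some i -> ieval W s f = Some z ->
    exec W (ISet a e f) s 1 (Store (upd (ints s) a i z) (reals s))
| ExecRSet s a e f i x :
    obind address (ieval W s e) = Some i -> reval W s f = Some x ->
    exec W (RSet a e f) s 1 (Store (ints s) (upd (reals s) a i x))
| ExecSeq s1 s2 s3 c d t u :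
    exec W c s1 t s2 -> exec W d s2 u s3 -> exec W (Seq c d) s1 (t + u) s3
| ExecIf s s' b c d v t :
    beval W s b = Some v -> exec W (if v then c else d) s t s' ->
    exec W (If b c d) s t.+1 s'
| ExecWhileEnd s b c :
    beval W s b = Some false -> exec W (While b c) s 1 s
| ExecWhileLoop s1 s2 s3 b c t u :
    beval W s1 b = Some true -> exec W c s1 t s2 ->
    exec W (While b c) s2 u s3 ->
    exec W (While b c) s1 (t + u).+1 s3.

(* Input: n and k in integer arrays 0 and 1, the abscissas, the ordinates and
   eps in real arrays 0, 1 and 2.  All other cells are unconstrained (working
   memory is not initialised). *)
Definition input_store (R : realType) (pts : seq (R * R)) (k : nat) (eps : R)
    (s : store R) : Prop :=
  [/\ ints s 0 0 = (size pts)%:Z,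
      ints s 1 0 = k%:Z,
      forall i, (i < size pts)%N -> reals s 0 i = (nth 0 pts i).1,
      forall i, (i < size pts)%N -> reals s 1 i = (nth 0 pts i).2
    & reals s 2 0 = eps].

(* Output: corner and side in cells 0, 1, 2 of real array 3. *)
Definition output_square (R : realType) (s : store R) : square R :=
  Square (reals s 3 0, reals s 3 1) (reals s 3 2).

(* Main.v *)
(** Let [n] be the number of points and [l] the minimal side.  A sorted chunk
of [g] numbers of which every fourth one is kept represents every interval up
to an error of 3 elements; iterating with chunks of doubling size divides the
list by four each time, so linear time yields a net of about [10 n / k] numbers
meeting every interval that contains [k] of the input numbers.  The same nets
supply the pivots of a deterministic linear-time selection.

With nets [X] and [Y] of the abscissas and the ordinates, every square
containing [k] points contains one of the O(1) vertices of [X * Y].  If [r] is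
the least distance (in the maximum norm) between a vertex and its k-th nearest
point, then [r <= l <= 2 r], and an optimal square lies in the box of side
[4 r] around one of the vertices.  Each box is cut into cells of side
[r / (2 N)], with [1 / N <= eps].  With prefix sums over the cells, the smallest
block of cells containing [k] points is found by one scan in which the best
size only decreases, in time O(N^2); its side is at most
[l + 2 r / (2 N) <= (1 + eps) l]. *)

From HB Require Import structures.
From mathcomp Require Import all_boot all_order all_algebra.
From mathcomp Require Import boolp reals exp.
From mathcomp Require Import zify ring lra.
Require Import Defs.

Set Implicit Arguments.
Unset Strict Implicit.
Unset Printing Implicit Defensive.

Import Order.TTheory GRing.Theory Num.Theory.

(** * Cost semantics *)

(** The program must not depend on the constant [c] with [c * n <= k]: it reads [n] and [k] and asks
    for nets of at most [10 * (n %/ k).+1] numbers. Only the analysis bounds this in terms of [c].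
    The number of vertices is then constant, so each vertex can afford its own linear-time selection
    and its own grid.

    The cells have positive side only if [r > 0]. This follows from distinctness of the points when
    [k > 1]; the case [k = 1] is answered by a degenerate square.

    The machine shapes the bookkeeping. Computed integers must not exceed [W], which is only linear
    in [n + 1 / eps ^ 2], so every stage carries word bounds. All integers that occur are naturals,
    and subtractions are ordered so that no intermediate result is negative. Working memory has
    arbitrary initial contents, so a cell is written before its value matters.

    The time is linear in [n + 1 / eps ^ 2]. The logarithm enters only in the final comparison with
    the stated bound; for [eps > 1] it is negative, and the term [n] pays for it. *)

Definition is_nat (z : int) : bool := if z is Posz _ then true else false.

Section Eval.
Variables (R : realType) (W : nat).
Implicit Types s : store R.

(** A total evaluator, meaningful only under [iok] and [rok], which collect the side conditions for
    agreement with the partial [ieval] and [reval]. With values and definedness apart, goals about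
    program text reduce by simplification. *)
Fixpoint iv s (e : iexp) : nat :=
  match e with
  | IConst z => absz z
  | IGet a e => absz (ints s a (iv s e))
  | IAdd e f => iv s e + iv s f
  | ISub e f => iv s e - iv s f
  | IMul e f => iv s e * iv s f
  | IFloor e => Num.truncn (rv s e)
  end
with rv s (e : rexp) : R :=
  match e with
  | ROfInt e => ((iv s e)%:R)%R
  | RGet a e => reals s a (iv s e)
  | RAdd e f => (rv s e + rv s f)%R
  | RSub e f => (rv s e - rv s f)%R
  | RMul e f => (rv s e * rv s f)%R
  | RDiv e f => (rv s e / rv s f)%R
  end.

Fixpoint iok s (e : iexp) : Prop :=
  match e with
  | IConst z => is_nat z
  | IGet a e => iok s e /\ is_nat (ints s a (iv s e))
  | IAdd e f => [/\ iok s e, iok s f & iv s e + iv s f <= W]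
  | ISub e f => [/\ iok s e, iok s f, iv s f <= iv s e & iv s e - iv s f <= W]
  | IMul e f => [/\ iok s e, iok s f & iv s e * iv s f <= W]
  | IFloor e => [/\ rok s e, (0 <= rv s e)%R & Num.truncn (rv s e) <= W]
  end
with rok s (e : rexp) : Prop :=
  match e with
  | ROfInt e => iok s e
  | RGet a e => iok s e
  | RAdd e f => rok s e /\ rok s f
  | RSub e f => rok s e /\ rok s f
  | RMul e f => rok s e /\ rok s f
  | RDiv e f => [/\ rok s e, rok s f & rv s f != 0%R]
  end.

Scheme iexp_mut := Induction for iexp Sort Prop
with rexp_mut := Induction for rexp Sort Prop.
Combined Scheme irexp_mut from iexp_mut, rexp_mut.

Lemma evalP s :
  (forall e, iok s e -> ieval W s e = Some (Posz (iv s e))) /\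
  (forall e, rok s e -> reval W s e = Some (rv s e)).
Proof.
apply: irexp_mut => /=.
- by case.
- by move=> a e IH [/IH -> /=]; case: (ints s a (iv s e)).
- by move=> e IHe f IHf [/IHe -> /IHf -> le_W] /=; rewrite /word -PoszD le_W.
- move=> e IHe f IHf [/IHe -> /IHf -> le_fe le_W] /=.
  by rewrite /word subzn // le_W.
- by move=> e IHe f IHf [/IHe -> /IHf -> le_W] /=; rewrite /word -PoszM le_W.
- move=> e IHe [/IHe -> e_ge0]; rewrite truncn_floor e_ge0 /= => le_W.
  by rewrite /word le_W gez0_abs // Num.Theory.floor_ge0.
- by move=> e IHe /IHe ->.
- by move=> a e IHe /IHe ->.
- by move=> e IHe f IHf [/IHe -> /IHf ->].
- by move=> e IHe f IHf [/IHe -> /IHf ->].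
- by move=> e IHe f IHf [/IHe -> /IHf ->].
- by move=> e IHe f IHf [/IHe -> /IHf -> /negbTE /= ->].
Qed.

Definition ievalP s := proj1 (evalP s).
Definition revalP s := proj2 (evalP s).

Fixpoint bv s (b : bexp) : bool :=
  match b with
  | BIntLe e f => iv s e <= iv s f
  | BRealLe e f => (rv s e <= rv s f)%R
  | BNot b => ~~ bv s b
  | BAnd b c => bv s b && bv s c
  end.

Fixpoint bok s (b : bexp) : Prop :=
  match b with
  | BIntLe e f => iok s e /\ iok s f
  | BRealLe e f => rok s e /\ rok s f
  | BNot b => bok s b
  | BAnd b c => bok s b /\ bok s c
  end.

Lemma bevalP s b : bok s b -> beval W s b = Some (bv s b).
Proof.
elim: b => /=.
- by move=> e f [/ievalP -> /ievalP ->].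
- by move=> e f [/revalP -> /revalP ->].
- by move=> b IH /IH ->.
- by move=> b IHb c IHc [/IHb -> /IHc ->].
Qed.

Definition iset s a j v : store R := Store (upd (ints s) a j (Posz v)) (reals s).
Definition rset s a j v : store R := Store (ints s) (upd (reals s) a j v).

Fixpoint iwrites (c : cmd) : seq nat :=
  match c with
  | Skip | RSet _ _ _ => [::]
  | ISet a _ _ => [:: a]
  | Seq c d | If _ c d => iwrites c ++ iwrites d
  | While _ c => iwrites c
  end.

Fixpoint rwrites (c : cmd) : seq nat :=
  match c with
  | Skip | ISet _ _ _ => [::]
  | RSet a _ _ => [:: a]
  | Seq c d | If _ c d => rwrites c ++ rwrites d
  | While _ c => rwrites c
  end.

(** Whole arrays rather than single cells are tracked, so that for closed program text the side
    conditions are decided by computation. *)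
Definition frame c s s' :=
  (forall a, a \notin iwrites c -> ints s' a = ints s a) /\
  (forall a, a \notin rwrites c -> reals s' a = reals s a).

Lemma frame_refl c s : frame c s s.
Proof. by []. Qed.

Lemma frame_trans c s1 s2 s3 : frame c s1 s2 -> frame c s2 s3 -> frame c s1 s3.
Proof.
by move=> [i1 r1] [i2 r2]; split=> a wa; [rewrite i2 ?i1 | rewrite r2 ?r1].
Qed.

Lemma frame_sub c d s s' :
  {subset iwrites c <= iwrites d} -> {subset rwrites c <= rwrites d} ->
  frame c s s' -> frame d s s'.
Proof.
move=> sub_i sub_r [fi fr]; split=> a wa.
  by apply: fi; apply: contra wa => /sub_i.
by apply: fr; apply: contra wa => /sub_r.
Qed.

Lemma upd_neq (T : Type) (m : nat -> nat -> T) a i v b :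
  b != a -> upd m a i v b = m b.
Proof. by move=> /negbTE neq_ba; rewrite /upd neq_ba. Qed.

Lemma upd_eq (T : Type) (m : nat -> nat -> T) a i v : upd m a i v a i = v.
Proof. by rewrite /upd !eqxx. Qed.

Lemma upd_neqi (T : Type) (m : nat -> nat -> T) a i v j :
  j != i -> upd m a i v a j = m a j.
Proof. by move=> /negbTE neq_ji; rewrite /upd neq_ji andbF. Qed.

Lemma exec_frame c s t s' : exec W c s t s' -> frame c s s'.
Proof.
elim=> {c s t s'} //.
- by move=> s a e f i z _ _; split=> b //= wb; apply: upd_neq; rewrite inE in wb.
- by move=> s a e f i z _ _; split=> b //= wb; apply: upd_neq; rewrite inE in wb.
- move=> s1 s2 s3 c d t u _ f1 _ f2; apply: (@frame_trans _ _ s2).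
    by apply: frame_sub f1 => a; rewrite mem_cat => ->.
  by apply: frame_sub f2 => a; rewrite mem_cat => ->; rewrite orbT.
- move=> s s' b c d v t _ _; apply: frame_sub => a; rewrite mem_cat;
    by case: v => ->; rewrite ?orbT.
- by move=> s1 s2 s3 b c t u _ _ f1 _; apply: frame_trans.
Qed.

Definition runs c s (T : nat) (Q : store R -> Prop) :=
  exists t s', [/\ exec W c s t s', t <= T & Q s'].

Lemma runs_weaken c s T T' (Q Q' : store R -> Prop) :
  runs c s T Q -> T <= T' -> (forall s', frame c s s' -> Q s' -> Q' s') ->
  runs c s T' Q'.
Proof.
move=> [t [s' [ex le_t Qs']]] le_T QQ'; exists t, s'; split=> //.
  exact: leq_trans le_T.
by apply: QQ' => //; apply: exec_frame ex.
Qed.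

Lemma runs_time c s T T' (Q : store R -> Prop) :
  runs c s T Q -> T <= T' -> runs c s T' Q.
Proof. by move=> r le_T; apply: runs_weaken r le_T _. Qed.

Lemma runs_seq c d s T1 T2 Q1 Q :
  runs c s T1 Q1 ->
  (forall s1, frame c s s1 -> Q1 s1 -> runs d s1 T2 Q) ->
  runs (Seq c d) s (T1 + T2) Q.
Proof.
move=> [t [s1 [ex1 le_t Q1s1]]] rd.
have [u [s2 [ex2 le_u Qs2]]] := rd s1 (exec_frame ex1) Q1s1.
by exists (t + u), s2; split=> //; [apply: ExecSeq ex1 ex2 | apply: leq_add].
Qed.

Lemma runs_while_end b c s (Q : store R -> Prop) :
  bok s b -> ~~ bv s b -> Q s -> runs (While b c) s 1 Q.
Proof.
move=> /bevalP eb /negbTE nb Qs; exists 1, s; split=> //.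
by apply: ExecWhileEnd; rewrite eb nb.
Qed.

Lemma runs_while_loop b c s T1 T2 Q1 Q :
  bok s b -> bv s b -> runs c s T1 Q1 ->
  (forall s1, frame c s s1 -> Q1 s1 -> runs (While b c) s1 T2 Q) ->
  runs (While b c) s (T1 + T2).+1 Q.
Proof.
move=> /bevalP eb tb [t [s1 [ex1 le_t Q1s1]]] rd.
have [u [s2 [ex2 le_u Qs2]]] := rd s1 (exec_frame ex1) Q1s1.
exists (t + u).+1, s2; split=> //; last by rewrite ltnS leq_add.
by apply: ExecWhileLoop ex1 ex2; rewrite eb tb.
Qed.

(** The measure is an index of the invariant, not a function of the store, so it may mention
    quantities that only the proof knows. *)
Lemma runs_while b c s0 B (I : nat -> store R -> Prop) (Q : store R -> Prop) m0 :
  (forall m s, frame c s0 s -> I m s -> bok s b /\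
     (if bv s b then runs c s B (fun s' => exists2 m', m' < m & I m' s')
      else Q s)) ->
  I m0 s0 -> runs (While b c) s0 (m0 * B.+1 + 1) Q.
Proof.
move=> step; suff run m s : frame c s0 s -> I m s ->
    runs (While b c) s (m * B.+1 + 1) Q by exact: run (frame_refl c s0).
elim/ltn_ind: m s => m IH s Fs Ims.
have [okb] := step m s Fs Ims.
case: ifP => [tb rc | /negbT nb Qs]; last first.
  by apply: runs_time (runs_while_end _ okb nb Qs) _; rewrite leq_addl.
have [m_gt0|] := ltnP 0 m; last first.
  by rewrite leqn0 => /eqP m_eq0; case: rc => [? [? [_ _ [? ]]]]; rewrite m_eq0.
apply: (@runs_time _ _ (B + (m.-1 * B.+1 + 1)).+1); last by case: m m_gt0 {IH Ims rc} => // m _ /=; lia.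
apply: (runs_while_loop okb tb rc) => s1 F1 [m' lt_m' Im's1].
apply: runs_time (IH m' lt_m' s1 (frame_trans Fs F1) Im's1) _.
by rewrite leq_add2r leq_mul2r; lia.
Qed.

Fixpoint straight c (Q : store R -> Prop) s : Prop :=
  match c with
  | Skip => Q s
  | ISet a e f => [/\ iok s e, iok s f & Q (iset s a (iv s e) (iv s f))]
  | RSet a e f => [/\ iok s e, rok s f & Q (rset s a (iv s e) (rv s f))]
  | Seq c d => straight c (straight d Q) s
  | If b c d => bok s b /\ (if bv s b then straight c Q s else straight d Q s)
  | While _ _ => False
  end.

Fixpoint cost c : nat :=
  match c with
  | Skip | ISet _ _ _ | RSet _ _ _ | While _ _ => 1
  | Seq c d => cost c + cost d
  | If _ c d => (cost c + cost d).+1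
  end.

Lemma runs_straight c s Q : straight c Q s -> runs c s (cost c) Q.
Proof.
elim: c s Q => //=.
- by move=> s Q Qs; exists 1, s; split=> //; constructor.
- move=> a e f s Q [oke okf Qs].
  exists 1, (iset s a (iv s e) (iv s f)); split=> //.
  by constructor; rewrite ievalP.
- move=> a e f s Q [oke okf Qs].
  exists 1, (rset s a (iv s e) (rv s f)); split=> //.
  by constructor; rewrite ?ievalP ?revalP.
- move=> c IHc d IHd s Q /IHc rc.
  by apply: (runs_seq rc) => s1 _; apply: IHd.
- move=> b c IHc d IHd s Q [okb].
  case E: (bv s b) => st; [have := IHc _ _ st | have := IHd _ _ st];
    move=> [t [s' [ex le_t Qs']]];
    exists t.+1, s'; (split=> //; last by rewrite ltnS; lia);
    by apply: ExecIf; rewrite ?bevalP // E.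
Qed.

Lemma runs_if b c d s T (Q : store R -> Prop) :
  bok s b -> runs (if bv s b then c else d) s T Q -> runs (If b c d) s T.+1 Q.
Proof.
move=> okb [t [s' [ex le_t Qs']]]; exists t.+1, s'; split=> //.
by apply: ExecIf; [apply: bevalP | ].
Qed.

End Eval.

Arguments frame : simpl never.

Definition scalar a := IGet a (IConst (Posz 0)).
Definition num (n : nat) := IConst (Posz n).
Definition idiv e f := IFloor (RDiv (ROfInt e) (ROfInt f)).
Definition assign a e := ISet a (num 0) e.

Definition For i m c :=
  Seq (assign i (num 0))
    (While (BNot (BIntLe (scalar m) (scalar i)))
       (Seq c (assign i (IAdd (scalar i) (num 1))))).

(** The invariant for [j.+1] is asked of the store with the counter already advanced, hence need not
    mention the counter. Increment and test add 2 steps per round. *)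
Lemma runs_for (R : realType) W (i m : nat) c (s : store R) n B
    (I : nat -> store R -> Prop) :
  i \notin m :: iwrites c -> m \notin iwrites c ->
  ints s m 0 = Posz n -> n <= W ->
  I 0 (iset s i 0 0) ->
  (forall j s', j < n -> frame (For i m c) s s' -> ints s' i 0 = Posz j ->
     I j s' -> runs W c s' B (fun s'' => I j.+1 (iset s'' i 0 j.+1))) ->
  runs W (For i m c) s (n * (B + 2) + 2) (I n).
Proof.
rewrite inE negb_or => /andP[neq_im wi] wm smn nW I0 step.
apply: (@runs_time _ _ _ _ (1 + (n * (B + 1).+1 + 1))); last by lia.
apply: runs_seq.
  by apply: (@runs_straight _ _ (assign i (num 0)) s (eq (iset s i 0 0))).
move=> s1 F0 eq_s1; subst s1.
set c' := Seq c _; set s0 := iset s i 0 0.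
pose J k s' := exists j, [/\ j <= n, k = n - j, ints s' i 0 = Posz j & I j s'].
apply: (@runs_while _ _ _ _ _ _ J); last first.
  exists 0; split=> //; rewrite ?subn0 // /s0 /iset /=.
  by rewrite upd_eq.
move=> k s' F [j [le_jn -> sij Ij]].
have smn' : ints s' m 0 = Posz n.
  rewrite (proj1 F) ?mem_cat /=; last by rewrite negb_or wm inE eq_sym.
  by rewrite /s0 /= upd_neq // eq_sym.
split; first by rewrite /= sij smn'.
rewrite /= sij smn' /= -ltnNge; case: ltnP => lt_jn; last first.
  by have -> : n = j by apply/eqP; rewrite eqn_leq le_jn lt_jn.
apply: runs_seq.
  apply: (step j) => //; apply: (@frame_trans _ _ _ s0).
    apply: frame_sub F0 => a //=.
    by rewrite !inE => /eqP ->; rewrite eqxx.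
  by apply: frame_sub F => a //=; rewrite inE => ->; rewrite orbT.
move=> s1 F1 I1; have s1ij : ints s1 i 0 = Posz j by rewrite (proj1 F1).
apply: (@runs_straight R W (assign i (IAdd (scalar i) (num 1))) s1) => /=.
rewrite s1ij /= addn1; split=> //; first by split=> //; apply: leq_trans nW.
exists (n - j.+1); first by rewrite subnSK.
by exists j.+1; split=> //=; rewrite upd_eq.
Qed.

(** * Loops *)

(** [isT] proves [a \notin iwrites c] by evaluation. Reads are thus moved back through earlier
    stores until a known fact applies. *)
Ltac framed := repeat match goal with
  | F : frame _ _ ?s' |- context [ints ?s' ?a] =>
      rewrite (proj1 F a isT); cbn [ints reals iset rset]
  | F : frame _ _ ?s' |- context [reals ?s' ?a] =>
      rewrite (proj2 F a isT); cbn [ints reals iset rset]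
  end.

Ltac reads := simpl; repeat match goal with
  | |- context [upd ?m ?a ?i ?v ?b] => rewrite (@upd_neq _ m a i v b isT)
  | |- context [upd ?m ?a ?i ?v ?a ?i] => rewrite (@upd_eq _ m a i v)
  | |- context [upd ?m ?a ?i ?v ?a ?j] => rewrite (@upd_neqi _ m a i v j isT)
  end; simpl.

Definition incr c := assign c (IAdd (scalar c) (num 1)).

Lemma count_iota_le p n : count p (iota 0 n) <= n.
Proof. by rewrite -{2}(size_iota 0 n) count_size. Qed.

Section Loops.
Variables (R : realType) (W : nat).
Implicit Types (s : store R) (l : seq R).

Definition holds (f : nat -> R) l := forall i, i < size l -> f i = nth 0%R l i.

Lemma runs_count s (i m c : nat) b n (p : nat -> bool) :
  uniq [:: i; m; c] -> ints s m 0 = Posz n -> n <= W ->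
  let body := If b (incr c) Skip in
  (forall j s', j < n -> frame (Seq (assign c (num 0)) (For i m body)) s s' ->
     ints s' i 0 = Posz j -> bok W s' b /\ bv s' b = p j) ->
  runs W (Seq (assign c (num 0)) (For i m body)) s (n * 5 + 3)
    (fun s' => ints s' c 0 = Posz (count p (iota 0 n))).
Proof.
rewrite /= !inE !negb_or -!andbA => /and4P[neq_im neq_ic neq_mc _] smn nW okb.
apply: (@runs_time _ _ _ _ (1 + (n * (3 + 2) + 2))); last by lia.
apply: runs_seq.
  by apply: (@runs_straight _ _ (assign c (num 0)) s (eq (iset s c 0 0))).
move=> s1 F1 eq_s1; subst s1.
pose C j := count p (iota 0 j).
have CS j : C j.+1 = C j + p j.
  by rewrite /C -addn1 iotaD cats1 -cats1 count_cat /= addn0.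
have Cle j : C j <= j by apply: count_iota_le.
apply: (runs_for (I := fun j s' => ints s' c 0 = Posz (C j))) (nW) _ _.
- by rewrite /= !inE negb_or neq_im neq_ic.
- by rewrite /= !inE.
- by rewrite /= upd_neq.
- by rewrite /= upd_neq 1?eq_sym //= upd_eq.
move=> j s' lt_jn F s'i s'c.
have F' : frame (Seq (assign c (num 0)) (For i m (If b (incr c) Skip))) s s'.
  apply: frame_trans (_ : frame _ s (iset s c 0 0)) _.
    by apply: frame_sub F1 => a //=; rewrite !inE => ->.
  by apply: frame_sub F => a //=; rewrite !inE => ->; rewrite orbT.
have [okb' vb] := okb j s' lt_jn F' s'i.
apply: (@runs_straight _ _ (If b (incr c) Skip)) => /=; split=> //.
rewrite vb CS; case: (p j); rewrite /= ?s'c /=.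
  split=> //; first by split=> //; rewrite addn1; apply: leq_ltn_trans (Cle j) _; apply: leq_trans nW.
  by rewrite upd_neq 1?eq_sym //= upd_eq.
by rewrite upd_neq 1?eq_sym // addn0.
Qed.

(** A filtering loop, specified by what one round does: append [f j] exactly when [p j] holds and
    keep the entries written so far. The bound on the write index [v] is offered to the body for its
    word bounds. *)
Lemma runs_collect s (i m w d : nat) c n (p : nat -> bool) (f : nat -> R) l0 B :
  i \notin [:: m, w & iwrites c] -> m \notin iwrites c ->
  ints s m 0 = Posz n -> n <= W ->
  ints s w 0 = Posz (size l0) -> holds (reals s d) l0 ->
  (forall j s' v, j < n -> v <= size l0 + j ->
     frame (For i m c) s s' -> ints s' i 0 = Posz j -> ints s' w 0 = Posz v ->
     runs W c s' B (fun s'' => [/\ ints s'' w 0 = Posz (v + p j),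
       p j -> reals s'' d v = f j &
       forall u, u < v -> reals s'' d u = reals s' d u])) ->
  runs W (For i m c) s (n * (B + 2) + 2) (fun s' =>
    let l := l0 ++ [seq f j | j <- iota 0 n & p j] in
    ints s' w 0 = Posz (size l) /\ holds (reals s' d) l).
Proof.
rewrite !inE !negb_or => /and3P[neq_im neq_iw wi] wm smn nW sw hd body.
pose L j := l0 ++ [seq f i | i <- iota 0 j & p i].
have LS j : L j.+1 = L j ++ (if p j then [:: f j] else [::]).
  rewrite /L -addn1 iotaD cats1 -cats1 filter_cat map_cat -catA /= add0n.
  by case: (p j).
have Lle j : size (L j) <= size l0 + j.
  by rewrite size_cat leq_add2l size_map size_filter count_iota_le.
apply: (runs_for (I := fun j s' => ints s' w 0 = Posz (size (L j)) /\
    holds (reals s' d) (L j))) (smn) (nW) _ _ => //.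
- by rewrite inE negb_or neq_im.
- by rewrite /= /L /= cats0 upd_neq // eq_sym.
move=> j s' lt_jn F s'i [s'w hd'].
apply: runs_weaken (body j s' _ lt_jn (Lle j) F s'i s'w) (leqnn _) _.
move=> s'' F'' [s''w fj keep]; rewrite LS.
rewrite /= upd_neq 1?eq_sym //.
case: (p j) s''w fj => /= s''w fj; last first.
  rewrite addn0 in s''w; rewrite cats0; split=> // u lt_u.
  by rewrite keep // hd'.
rewrite size_cat /= s''w; split=> // u; rewrite size_cat /= addn1 ltnS.
rewrite nth_cat leq_eqVlt => /orP[/eqP ->|lt_u].
  by rewrite ltnn subnn /= fj.
by rewrite lt_u keep // hd'.
Qed.

Definition copy d a m := For 5 m (RSet d (scalar 5) (RGet a (scalar 5))).

Lemma runs_copy s d a m l :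
  d != a -> m != 5 -> ints s m 0 = Posz (size l) -> size l <= W ->
  holds (reals s a) l ->
  runs W (copy d a m) s (size l * 3 + 2) (fun s' => holds (reals s' d) l).
Proof.
move=> neq_da neq_m5 sm lW hl.
pose I j s' := forall i, i < j -> reals s' d i = nth 0%R l i.
apply: (@runs_for _ _ 5 m _ s (size l) 1 I) => //.
  by rewrite inE eq_sym.
move=> j s' lt_jl F s'5 Ij.
apply: (@runs_straight _ _ (RSet d (scalar 5) (RGet a (scalar 5)))) => /=.
rewrite s'5 /=; split=> // i; rewrite ltnS leq_eqVlt => /orP[/eqP ->|lt_ij] /=.
  by rewrite upd_eq (proj2 F) ?hl //= inE eq_sym.
by rewrite upd_neqi ?Ij // neq_ltn lt_ij.
Qed.

End Loops.

(** * Keeping every fourth element *)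

Lemma iotaS_rcons n : iota 0 n.+1 = rcons (iota 0 n) n.
Proof. by rewrite -addn1 iotaD cats1. Qed.

Lemma count_iotaS p n : count p (iota 0 n.+1) = count p (iota 0 n) + p n.
Proof. by rewrite iotaS_rcons -cats1 count_cat /= addn0. Qed.

(** Covers intervals of every kind: closed ones come from squares, open and half-open ones from
    successive pivots. *)
Definition convex_pred (disp : Order.disp_t) (T : porderType disp)
    (P : pred T) := forall x y z : T, (x <= y <= z)%O -> P x -> P z -> P y.

Lemma convex_nat_interval (Q : pred nat) n :
  (forall x y z, x <= y <= z -> z < n -> Q x -> Q z -> Q y) ->
  exists a b, [/\ a <= b, b <= n & forall r, r < n -> Q r = (a <= r < b)].
Proof.
elim: n => [|n IH] cQ; first by exists 0, 0.
have [|a [b [ab bn Qab]]] := IH.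
  by move=> x y z xyz zn; apply: cQ => //; apply: ltnW.
have [Qn|nQn] := boolP (Q n); last first.
  exists a, b; split=> //; first exact: leqW.
  move=> r; rewrite ltnS leq_eqVlt => /orP[/eqP ->|/Qab //].
  by rewrite (negbTE nQn); lia.
have [eq_ab|neq_ab] := eqVneq a b.
  exists n, n.+1; split=> // r; rewrite ltnS leq_eqVlt => /orP[/eqP ->|lt_rn].
    by rewrite Qn; lia.
  by rewrite Qab // eq_ab; lia.
exists a, n.+1; split=> //; first by lia.
move=> r; rewrite ltnS leq_eqVlt => /orP[/eqP ->|lt_rn].
  by rewrite Qn; lia.
have Qa : Q a by rewrite Qab; lia.
rewrite lt_rn orbT andbT; have [ar|ra] := leqP a r.
  by apply: (cQ a r n) => //; lia.
by rewrite Qab //; lia.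
Qed.

Lemma count_interval a b n : a <= b -> b <= n ->
  count (fun r => a <= r < b) (iota 0 n) = b - a.
Proof.
move=> ab bn; suff -> : count (fun r => a <= r < b) (iota 0 n) =
  minn b n - minn a n by lia.
by elim: n {bn} => [|n IH]; [rewrite /=; lia | rewrite count_iotaS IH; lia].
Qed.

(** [2 < r %% 4] means that 4 divides [r.+1], so exactly [b %/ 4] such numbers lie below [b]. *)
Lemma count_interval_mod4 a b n : a <= b -> b <= n ->
  count (fun r => (a <= r < b) && (2 < r %% 4)) (iota 0 n) = b %/ 4 - a %/ 4.
Proof.
move=> ab bn; suff -> : count (fun r => (a <= r < b) && (2 < r %% 4)) (iota 0 n)
  = minn b n %/ 4 - minn a n %/ 4 by lia.
elim: n {bn} => [|n IH]; [by rewrite /=; lia | rewrite count_iotaS IH; lia].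
Qed.

Lemma count_convex_mod4 (Q : pred nat) n :
  (forall x y z, x <= y <= z -> z < n -> Q x -> Q z -> Q y) ->
  count Q (iota 0 n) <= count (fun r => Q r && (2 < r %% 4)) (iota 0 n) * 4 + 3.
Proof.
move=> /convex_nat_interval [a [b [ab bn Qab]]].
have -> : count Q (iota 0 n) = count (fun r => a <= r < b) (iota 0 n).
  by apply: eq_in_count => r; rewrite mem_iota => /Qab.
have -> : count (fun r => Q r && (2 < r %% 4)) (iota 0 n) =
    count (fun r => (a <= r < b) && (2 < r %% 4)) (iota 0 n).
  by apply: eq_in_count => r; rewrite mem_iota => /Qab ->.
by rewrite count_interval // count_interval_mod4 //; lia.
Qed.

Section Fourths.
Variable R : realType.
Implicit Types (l : seq R).

(** The strict lexicographic order on value and index, so that equal values get distinct ranks. The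
    shape is that of the test in [chunk]; [beforeE] gives the readable form. *)
Definition before l j i : bool :=
  ~~ ((nth 0 l i <= nth 0 l j) && ~~ ((nth 0 l j <= nth 0 l i) && (j < i)%N))%R.

Definition rank l i := count (before l ^~ i) (iota 0 (size l)).

(** Nothing is sorted: ranks are found by counting, and the elements of ranks 3, 7, 11, ... stay in
    their order of occurrence. *)
Definition fourths l :=
  [seq nth 0%R l i | i <- iota 0 (size l) & 2 < rank l i %% 4].

Lemma beforeE l j i : before l j i =
  (nth 0 l j < nth 0 l i)%R || (nth 0 l j <= nth 0 l i)%R && (j < i).
Proof. by rewrite /before negb_and negbK -ltNge. Qed.

Lemma before_trans l : transitive (before l).
Proof.
move=> j i k; rewrite !beforeE.
case/orP=> [lt_ij|/andP[le_ij ij]] /orP[lt_jk|/andP[le_jk jk]]; apply/orP.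
- by left; apply: lt_trans lt_jk.
- by left; apply: lt_le_trans le_jk.
- by left; apply: le_lt_trans lt_jk.
- by right; rewrite (le_trans le_ij) // (ltn_trans ij).
Qed.

Lemma before_irr l i : before l i i = false.
Proof. by rewrite beforeE ltxx ltnn andbF. Qed.

Lemma before_le l i j : before l i j -> (nth 0 l i <= nth 0 l j)%R.
Proof. by rewrite beforeE => /orP[/ltW //|/andP[]]. Qed.

Lemma before_total l i j : i != j -> before l i j || before l j i.
Proof.
rewrite !beforeE neq_ltn.
by case: (ltgtP (nth 0%R l i) (nth 0%R l j)).
Qed.

Lemma rank_lt l i : i < size l -> rank l i < size l.
Proof.
move=> lt_i; rewrite -[X in _ < X](size_iota 0 (size l)).
rewrite -(count_predC (before l ^~ i)) -addn1 leq_add2l -has_count.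
by apply/hasP; exists i; rewrite ?mem_iota //= before_irr.
Qed.

Lemma rank_before l i j : i < size l -> before l i j -> rank l i < rank l j.
Proof.
move=> lt_i ij; rewrite /rank.
have -> : count (before l ^~ j) (iota 0 (size l)) =
    count (before l ^~ i) (iota 0 (size l)) +
    count (fun k => before l k j && ~~ before l k i) (iota 0 (size l)).
  rewrite -(count_predUI (before l ^~ i)).
  rewrite [X in _ + X](eq_count (a2 := pred0)); last first.
    by move=> k /=; case: (before l k i); rewrite // andbF.
  rewrite count_pred0 addn0; apply: eq_count => k /=.
  case E: (before l k i) => /=; last by rewrite andbT.
  by rewrite (before_trans E ij).
rewrite -addn1 leq_add2l -has_count; apply/hasP; exists i.
  by rewrite mem_iota.
by rewrite ij before_irr.
Qed.

Lemma rank_inj l : {in iota 0 (size l) &, injective (rank l)}.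
Proof.
move=> i j; rewrite !mem_iota /= => lt_i lt_j eq_r; apply/eqP.
apply/negP => /negP /(before_total l) /orP[/rank_before|/rank_before] => /(_ _);
  by rewrite eq_r ltnn => /(_ _); auto.
Qed.

(** An injection of the first [size l] naturals into themselves is a permutation; counting over
    positions thus becomes counting over ranks. *)
Lemma perm_rank l : perm_eq [seq rank l i | i <- iota 0 (size l)] (iota 0 (size l)).
Proof.
have uniq_r : uniq [seq rank l i | i <- iota 0 (size l)].
  by rewrite map_inj_in_uniq ?iota_uniq //; apply: rank_inj.
apply: uniq_perm => //; first exact: iota_uniq.
apply: (uniq_min_size uniq_r _ _).2; last by rewrite size_map.
move=> r /mapP[i]; rewrite mem_iota => lt_i ->.
by rewrite mem_iota rank_lt.
Qed.

Lemma count_rank l (p : pred nat) :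
  count (fun i => p (rank l i)) (iota 0 (size l)) = count p (iota 0 (size l)).
Proof. by rewrite -[RHS](permP (perm_rank l)) count_map. Qed.

Lemma size_fourths l : size (fourths l) * 4 <= size l.
Proof.
rewrite size_map size_filter (count_rank l (fun r => 2 < r %% 4)).
rewrite (eq_in_count (a2 := fun r => (0 <= r < size l) && (2 < r %% 4))).
  by rewrite count_interval_mod4 //; lia.
by move=> r; rewrite mem_iota => /= ->.
Qed.

Lemma count_nth_iota l (P : pred R) :
  count P l = count (fun i => P (nth 0%R l i)) (iota 0 (size l)).
Proof. by rewrite -{1}(mkseq_nth 0%R l) count_map. Qed.

(** The elements in an interval have consecutive ranks, so the claim is [count_convex_mod4]
    transported along the permutation [rank l], with [inv] as its inverse. *)
Lemma count_fourths l (P : pred R) : convex_pred P ->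
  count P l <= count P (fourths l) * 4 + 3.
Proof.
move=> cP; pose inv r := index r [seq rank l i | i <- iota 0 (size l)].
have inv_rank i : i < size l -> inv (rank l i) = i.
  move=> lt_i.
  have nth_rank : nth 0 [seq rank l i | i <- iota 0 (size l)] i = rank l i.
    by rewrite (nth_map 0) ?size_iota // nth_iota.
  rewrite /inv -nth_rank index_uniq ?size_map ?size_iota //.
  by rewrite map_inj_in_uniq ?iota_uniq //; apply: rank_inj.
have rank_inv r : r < size l -> exists2 i, i < size l & r = rank l i.
  move=> lt_r; have : r \in iota 0 (size l) by rewrite mem_iota.
  by rewrite -(perm_mem (perm_rank l)) => /mapP[i]; rewrite mem_iota; exists i.
pose Q r := P (nth 0%R l (inv r)).
have PQ i : i < size l -> P (nth 0%R l i) = Q (rank l i).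
  by move=> lt_i; rewrite /Q inv_rank.
rewrite count_nth_iota.
rewrite (eq_in_count (a2 := fun i => Q (rank l i))); last first.
  by move=> i; rewrite mem_iota => /PQ.
rewrite (count_rank l Q) /fourths count_map count_filter.
rewrite [X in _ <= X * 4 + _](eq_in_count
  (a2 := fun i => Q (rank l i) && (2 < rank l i %% 4))); last first.
  by move=> i; rewrite mem_iota => /PQ /= ->.
rewrite (count_rank l (fun r => Q r && (2 < r %% 4))).
apply: count_convex_mod4 => x y z /andP[xy yz] zn.
have yn := leq_ltn_trans yz zn; have xn := leq_ltn_trans xy yn.
have [i ni ei] := rank_inv x xn; have [j nj ej] := rank_inv y yn.
have [k nk ek] := rank_inv z zn; move: xy yz; rewrite ei ej ek -!PQ // => xy yz.
have mono i' j' : i' < size l -> j' < size l ->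
    rank l i' <= rank l j' -> (nth 0 l i' <= nth 0 l j')%R.
  move=> ni' nj' le_r; have [->//|neq] := eqVneq i' j'.
  have /orP[/before_le //|/rank_before] := before_total l neq.
  by move=> /(_ nj'); rewrite ltnNge le_r.
by apply: cP; rewrite !mono.
Qed.

End Fourths.

(** * Iterated thinning and the gaps it can leave *)

Section Sampled.
Variable R : realType.
Implicit Types (l : seq R) (P : pred R).

(** Relations that follow the two nested loops of [net]: one pass over the chunks, then passes with
    doubled chunk size until at most [G] elements remain. *)
Inductive thinned g : seq R -> seq R -> Prop :=
| thinned_nil : thinned g [::] [::]
| thinned_cat l t : l != [::] -> thinned g (drop g l) t ->
    thinned g l (fourths (take g l) ++ t).

Inductive sampled (G : nat) : nat -> seq R -> seq R -> Prop :=
| sampled_stop g l : size l <= G -> sampled G g l l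
| sampled_thin g l t X : G < size l -> thinned g l t ->
    sampled G (g + g) t X -> sampled G g l X.

Lemma size_thinned g l t : thinned g l t -> size t * 4 <= size l.
Proof.
elim=> // {}l {}t _ _ IH.
rewrite size_cat -[X in _ <= size X](cat_take_drop g l) size_cat.
by rewrite mulnDl leq_add ?size_fourths.
Qed.

Lemma size_sampled G g l X : sampled G g l X -> size X <= G.
Proof. by elim. Qed.

(** Each chunk loses at most 3 elements, and a nonempty list has at most [size l / g + 1] chunks;
    multiplication by [g] avoids the division. *)
Lemma count_thinned g l t P : 0 < g -> convex_pred P -> thinned g l t ->
  g * count P l <= 4 * g * count P t + 3 * (size l + (l != [::]) * g).
Proof.
move=> g0 cP; elim=> [|{}l {}t l0 _ IH]; first by rewrite muln0.
rewrite -{1}(cat_take_drop g l) !count_cat l0 mul1n.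
have cf := count_fourths (take g l) cP.
have size_l : size l = size (take g l) + size (drop g l).
  by rewrite -size_cat cat_take_drop.
have [le_lg|lt_gl] := leqP (size l) g.
  rewrite drop_oversize // in IH *; move: IH => /=; nia.
have d0 : (drop g l != [::]) <= 1 by case: (_ != _).
have size_t : size (take g l) = g by rewrite size_takel // ltnW.
move: IH; rewrite size_l size_t; nia.
Qed.

(* [w] is the number of input elements that one element of [l] stands for and
   [n] bounds the size of the input.  Chunk sizes double while list sizes are
   divided by four, so that the errors of the levels form geometric series. *)
Lemma sampled_gap G g l X P : 0 < G -> convex_pred P ->
  sampled G g l X -> ~~ has P X ->
  forall w n, G <= g -> w * size l <= n ->
  count P l = 0 \/ w * g * G * (count P l).+1 <= 6 * n * G + 4 * n * g.
Proof.
move=> G0 cP; elim=> [{}g {}l _|{}g {}l t {}X lt_Gl th _ IH] PX w n Gg le_n.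
  by left; apply/eqP; rewrite -leqn0 leqNgt -has_count.
right; have g0 := leq_trans G0 Gg.
have cl : g * count P l <= 4 * g * count P t + 3 * (size l + g).
  apply: leq_trans (count_thinned g0 cP th) _.
  by case: (_ != _); rewrite leq_add2l leq_mul2l ?mul1n //= leq_add2l.
have le_t := size_thinned th.
have wcl : w * G * (g * count P l) <=
    w * G * (4 * g * count P t + 3 * (size l + g)) by rewrite leq_mul2l cl orbT.
have wl : G * (w * size l) <= G * n by rewrite leq_mul2l le_n orbT.
have wG : g * (w * G) <= g * n.
  rewrite leq_mul2l (leq_trans _ le_n) ?orbT //.
  by rewrite leq_mul2l ltnW ?orbT.
(* An element of [t] stands for [4 * w] inputs. After halving, the successor in the bound for [t] is
   worth [4 * w * g * G]; the last, possibly partial chunk uses three of these four parts, and the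
   fourth restores the successor for [l]. *)
have [||c0|gap] := IH PX (4 * w) n.
- by lia.
- by apply: leq_trans le_n; nia.
- by move: wcl; rewrite c0; lia.
by lia.
Qed.

(** The case [w = 1] and [g = G] of [sampled_gap]; the constant 10 is [6 + 4]. *)
Lemma sampled_net G l X P : 0 < G -> convex_pred P -> sampled G G l X ->
  ~~ has P X -> count P l = 0 \/ (count P l).+1 * G <= 10 * size l.
Proof.
move=> G0 cP sX PX.
have [||->|gap] := sampled_gap G0 cP sX PX (w := 1) (n := size l).
- by [].
- by rewrite mul1n.
- by left.
right; rewrite -(leq_pmul2r G0); nia.
Qed.

End Sampled.

(** * Nets for intervals *)

(* Memory of the program.  Integer arrays: 0 n, 1 k; net: 2 list size, 3 chunk
   size, 4 bound on the final size, 5 copy index, 6 unread, 7 read position,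
   8 write position, 9 chunk length, 10 and 11 positions in the chunk, 12 rank;
   selection: 13 candidates, 14 wanted rank, 15 pivot index, 16 and 17 numbers
   of candidates below and up to the pivot, 18 candidate or point index, 19
   write position; vertices: 20 |X|, 21 |Y|, 22 vertex index, 23 its abscissa
   index, 24 |X| |Y|; grid: 25 N, 26 M = cells per side, 27 block size, 28 cell
   counts, 29 prefix sums, 30 index, 31 M^2, 32 M+1, 33 (M+1)^2, 34 and 35 lower
   and 36 and 37 upper cell coordinates of a block, 38 its number of points.
   Real arrays: 0 abscissas, 1 ordinates, 2 eps, 3 output, 4 list to be thinned,
   5 scratch, 6 candidates, 7 X, 8 Y, 9 selected value, 10 pivot, 12 least
   radius, 13 and 14 vertex, 15 cell side, 16 and 17 corner of the box. *)
Definition chunk :=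
  Seq (If (BIntLe (scalar 3) (scalar 6)) (assign 9 (scalar 3))
         (assign 9 (scalar 6)))
 (Seq (For 10 9
   (Seq (Seq (assign 12 (num 0)) (For 11 9
      (If (BNot (BAnd (BRealLe (RGet 4 (IAdd (scalar 7) (scalar 10)))
                                (RGet 4 (IAdd (scalar 7) (scalar 11))))
                (BNot (BAnd (BRealLe (RGet 4 (IAdd (scalar 7) (scalar 11)))
                                     (RGet 4 (IAdd (scalar 7) (scalar 10))))
                            (BNot (BIntLe (scalar 10) (scalar 11)))))))
          (incr 12) Skip)))
      (If (BNot (BIntLe (ISub (scalar 12)
                 (IMul (num 4) (idiv (scalar 12) (num 4))))
                 (num 2)))
          (Seq (RSet 5 (scalar 8) (RGet 4 (IAdd (scalar 7) (scalar 10))))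
               (incr 8))
          Skip)))
 (Seq (assign 7 (IAdd (scalar 7) (scalar 9)))
      (assign 6 (ISub (scalar 6) (scalar 9))))).

Definition level :=
  Seq (Seq (assign 6 (scalar 2)) (Seq (assign 7 (num 0)) (assign 8 (num 0))))
 (Seq (While (BIntLe (num 1) (scalar 6)) chunk)
 (Seq (assign 2 (scalar 8))
 (Seq (copy 4 5 2)
      (assign 3 (IAdd (scalar 3) (scalar 3)))))).

Definition net :=
  Seq (assign 3 (scalar 4))
      (While (BNot (BIntLe (scalar 2) (scalar 4))) level).

Section Net.
Variables (R : realType) (W : nat).
Implicit Types (s : store R) (l : seq R).

Lemma truncn_div (a b : nat) :
  0 < b -> Num.truncn (a%:R / b%:R : R)%R = a %/ b.
Proof.
move=> b_gt0; apply: truncn_def.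
rewrite ler_pdivlMr ?ltr0n // ltr_pdivrMr ?ltr0n // -!natrM ler_nat ltr_nat.
by rewrite leq_trunc_div ltn_ceil.
Qed.

(** Counting ranks costs [5 * g] steps per element of the chunk. The hypothesis [size acc <= p]
    keeps the write index within the word bound. *)
Lemma runs_chunk s g l p acc :
  ints s 3 0 = Posz g -> ints s 6 0 = Posz (size l - p) ->
  ints s 7 0 = Posz p -> ints s 8 0 = Posz (size acc) ->
  0 < g -> p < size l -> size acc <= p -> size l <= W -> g <= W ->
  holds (reals s 4) l -> holds (reals s 5) acc ->
  let len := minn g (size l - p) in
  runs W chunk s (len * (5 * g + 9) + 7) (fun s' =>
    let acc' := acc ++ fourths (take g (drop p l)) in
    [/\ ints s' 6 0 = Posz (size l - (p + len)), ints s' 7 0 = Posz (p + len),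
        ints s' 8 0 = Posz (size acc') & holds (reals s' 5) acc']).
Proof.
move=> s3 s6 s7 s8 g_gt0 lt_pl le_acc lW gW hl hacc len.
set c := take g (drop p l).
have size_c : size c = len by rewrite size_take_min size_drop.
have len_g : len <= g by rewrite geq_minl.
have len_l : p + len <= size l by rewrite /len; lia.
have nth_c i : i < len -> nth 0%R c i = nth 0%R l (p + i).
  by move=> lt_i; rewrite nth_take ?nth_drop //; apply: leq_trans lt_i _.
apply: (@runs_time _ _ _ _ (3 + ((len * (5 * g + 7 + 2) + 2) + 2))); last by lia.
apply: (runs_seq (Q1 := fun s' => ints s' 9 0 = Posz len)).
  apply: (@runs_straight _ _ (If (BIntLe (scalar 3) (scalar 6))
    (assign 9 (scalar 3)) (assign 9 (scalar 6)))) => /=.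
  rewrite s3 s6 /= /len /minn; split=> //.
  by case: ifP; case: ifP => // *; split=> //=; congr Posz; lia.
move=> s1 F1 s1_9.
apply: runs_seq.
  apply: (@runs_collect _ W s1 10 9 8 5 _ len (fun i => 2 < rank c i %% 4)
    (nth 0%R c) acc (5 * g + 7)) => //; framed => //.
    by lia.
  move=> i s2 v lt_i le_v F2 s2_10 s2_8.
  have s2_7 : ints s2 7 0 = Posz p by framed.
  have s2_9 : ints s2 9 0 = Posz len by framed.
  apply: (@runs_time _ _ _ _ ((len * 5 + 3) + 4)); last by lia.
  apply: runs_seq.
    apply: (@runs_count _ W s2 11 9 12 _ len (before c ^~ i)) => //; first by lia.
    move=> j s3' lt_j F3 s3_11 /=.
    have -> : ints s3' 7 0 = Posz p by framed.
    have -> : ints s3' 10 0 = Posz i by framed.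
    rewrite s3_11 /=; split; first by do !split => //; lia.
    framed; rewrite /before !nth_c // !hl ?ltnNge //; lia.
  move=> s3' F3; rewrite -size_c -/(rank c i); set r := rank c i => s3_12.
  have r_le : r <= len by rewrite -size_c count_iota_le.
  apply: runs_straight => /=.
  have -> : ints s3' 7 0 = Posz p by framed.
  have -> : ints s3' 8 0 = Posz v by framed.
  have -> : ints s3' 10 0 = Posz i by framed.
  rewrite s3_12 /= truncn_div // -ltnNge.
  have le_r := leq_trunc_div r 4.
  have -> : r - 4 * (r %/ 4) = r %% 4 by rewrite mulnC {1}(divn_eq r 4) addKn.
  split.
    do !split => //; rewrite ?pnatr_eq0 ?divr_ge0 ?ler0n //; lia.
  case: (2 < r %% 4) => /=.
    split=> //; first by split=> //; lia.
    split=> //; first by split=> //; lia.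
    split=> //.
      by move=> _; framed; rewrite upd_eq hl ?nth_c //; lia.
    by move=> u lt_u; rewrite upd_neqi ?neq_ltn ?lt_u //; framed.
  by split=> //; [framed; rewrite addn0 | move=> u _; framed].
move=> s2 F2 /= [s2_8 hacc'].
apply: runs_straight; reads.
have -> : ints s2 6 0 = Posz (size l - p) by framed.
have -> : ints s2 7 0 = Posz p by framed.
have -> : ints s2 9 0 = Posz len by framed.
rewrite /= -subnDA s2_8 /fourths size_c.
by do !split => //; lia.
Qed.

Lemma runs_chunks s g l p acc :
  ints s 3 0 = Posz g -> ints s 6 0 = Posz (size l - p) ->
  ints s 7 0 = Posz p -> ints s 8 0 = Posz (size acc) ->
  0 < g -> p <= size l -> size acc <= p -> size l <= W -> g <= W ->
  holds (reals s 4) l -> holds (reals s 5) acc ->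
  runs W (While (BIntLe (num 1) (scalar 6)) chunk) s
    ((size l - p) * (5 * g + 17) + 1) (fun s' => exists2 t,
      thinned g (drop p l) t &
      ints s' 8 0 = Posz (size (acc ++ t)) /\ holds (reals s' 5) (acc ++ t)).
Proof.
move: {2}(size l - p) (leqnn (size l - p)) => b.
elim: b s p acc => [|b IH] s p acc le_b s3 s6 s7 s8 g0 pl accp lW gW hl hacc.
  apply: (@runs_time _ _ _ _ 1); last by lia.
  apply: runs_while_end => /=; [by rewrite s6 | by rewrite s6 /=; lia | ].
  exists [::]; last by rewrite cats0.
  by rewrite drop_oversize; [constructor | lia].
have [lt_pl|ge_pl] := ltnP p (size l); last first.
  apply: (@runs_time _ _ _ _ 1); last by lia.
  apply: runs_while_end => /=; [by rewrite s6 | by rewrite s6 /=; lia | ].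
  exists [::]; last by rewrite cats0.
  by rewrite drop_oversize; [constructor | lia].
set len := minn g (size l - p).
have len_gt0 : 0 < len by rewrite /len; lia.
have len_g : len <= g by rewrite geq_minl.
have len_l : p + len <= size l by rewrite /len; lia.
apply: (@runs_time _ _ _ _ ((len * (5 * g + 9) + 7) +
    ((size l - (p + len)) * (5 * g + 17) + 1)).+1); last first.
  have -> : size l - p = len + (size l - (p + len)) by lia.
  rewrite mulnDl; nia.
apply: runs_while_loop.
- by rewrite /= s6.
- by rewrite /= s6 /=; lia.
- exact: runs_chunk s3 s6 s7 s8 g0 lt_pl accp lW gW hl hacc.
move=> s1 F1 /= [s1_6 s1_7 s1_8 hacc1].
have size_f : size (fourths (take g (drop p l))) <= len.
  by have := size_fourths (take g (drop p l)); rewrite size_take_min size_drop; lia.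
apply: runs_weaken (IH s1 (p + len) _ _ _ s1_6 s1_7 s1_8 g0 len_l _ lW gW _ hacc1)
  (leqnn _) _.
- lia.
- by framed.
- by rewrite size_cat leq_add.
- by framed.
move=> s2 _ [t th [s2_8 hacc2]].
exists (fourths (take g (drop p l)) ++ t); last by rewrite catA.
apply: thinned_cat; first by rewrite -size_eq0 size_drop -lt0n subn_gt0.
have [le_g|lt_g] := leqP g (size l - p).
  by rewrite drop_drop addnC; move: th; rewrite /len (minn_idPl le_g).
rewrite drop_drop drop_oversize; last by lia.
by rewrite drop_oversize in th; last by rewrite /len; lia.
Qed.

Lemma runs_level s g l :
  ints s 2 0 = Posz (size l) -> ints s 3 0 = Posz g ->
  0 < g -> size l <= W -> g + g <= W -> holds (reals s 4) l ->
  runs W level s (size l * (5 * g + 20) + 8) (fun s' =>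
    exists2 t, thinned g l t &
      [/\ ints s' 2 0 = Posz (size t), ints s' 3 0 = Posz (g + g) &
        holds (reals s' 4) t]).
Proof.
move=> s2 s3 g0 lW gW hl.
apply: (@runs_time _ _ _ _ (3 + (((size l - 0) * (5 * g + 17) + 1) +
   (1 + ((size l * 3 + 2) + 1))))); last by rewrite subn0; lia.
apply: (runs_seq (Q1 := fun s' => [/\ ints s' 6 0 = Posz (size l - 0),
    ints s' 7 0 = Posz 0 & ints s' 8 0 = Posz 0])).
  by apply: runs_straight; reads; rewrite s2 /= subn0; do !split.
move=> s1 F1 [s1_6 s1_7 s1_8].
apply: runs_seq.
  apply: (runs_chunks (g := g) (l := l) (p := 0) (acc := [::])) => //.
  - by framed.
  - by rewrite (leq_trans _ gW) // leq_addr.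
  - by framed.
move=> s4 F4 [t th]; rewrite drop0 in th; move=> /= [s4_8 hacc].
have le_t : size t <= size l by have := size_thinned th; lia.
apply: (runs_seq (Q1 := fun s' => ints s' 2 0 = Posz (size t))).
  by apply: runs_straight; reads; rewrite s4_8; do !split.
move=> s5 F5 s5_2.
apply: runs_seq.
  apply: (@runs_time _ _ _ _ (size t * 3 + 2)); last by lia.
  apply: runs_copy => //; first by apply: leq_trans lW.
  by framed.
move=> s6 F6 ht; apply: runs_straight; reads.
have -> : ints s6 3 0 = Posz g by framed.
rewrite /=; split=> //; exists t => //; split=> //; by framed.
Qed.

(** The next level has twice the chunk size and at most a quarter of the elements, so the dominant
    cost [5 * g * size l] halves and the sum is at most doubled. For the same reason
    [g * size l * 2 <= W] is preserved; it bounds the doubled chunk size. *)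
Lemma runs_net_loop s G g l :
  ints s 2 0 = Posz (size l) -> ints s 3 0 = Posz g -> ints s 4 0 = Posz G ->
  0 < g -> size l <= W -> g * size l * 2 <= W -> holds (reals s 4) l ->
  runs W (While (BNot (BIntLe (scalar 2) (scalar 4))) level) s
    (size l * (10 * g + 40) + 1) (fun s' => exists2 X, sampled G g l X &
      ints s' 2 0 = Posz (size X) /\ holds (reals s' 4) X).
Proof.
move: {2}(size l) (leqnn (size l)) => b.
elim: b s g l => [|b IH] s g l le_b s2 s3 s4 g0 lW glW hl.
  apply: (@runs_time _ _ _ _ 1); last by lia.
  apply: runs_while_end => /=; [by rewrite s2 s4 | by rewrite s2 s4 /=; lia | ].
  by exists l => //; constructor; lia.
have [le_lG|lt_Gl] := leqP (size l) G.
  apply: (@runs_time _ _ _ _ 1); last by lia.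
  apply: runs_while_end => /=; [by rewrite s2 s4 | by rewrite s2 s4 /=; lia | ].
  by exists l => //; constructor.
apply: runs_time.
  apply: runs_while_loop.
  - by rewrite /= s2 s4.
  - by rewrite /= s2 s4 /= -ltnNge.
  - by apply: (runs_level s2 s3) => //; nia.
  move=> s1 F1 [t th [s1_2 s1_3 ht]].
  have le_t := size_thinned th.
  apply: (runs_time (T := size l * (5 * g + 10) + 1)); last exact: leqnn.
  apply: runs_weaken (IH s1 (g + g) t _ s1_2 s1_3 _ _ _ _ ht) _ _ => //.
  - by lia.
  - by framed.
  - by lia.
  - by lia.
  - by nia.
  - by nia.
  move=> s' _ [X sX [s'2 hX]]; exists X => //.
  exact: sampled_thin th sX.
by nia.
Qed.

Lemma runs_net s G l :
  ints s 2 0 = Posz (size l) -> ints s 4 0 = Posz G ->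
  0 < G -> size l <= W -> G * size l * 2 <= W -> holds (reals s 4) l ->
  G <= W ->
  runs W net s (size l * (10 * G + 40) + 2) (fun s' =>
    exists2 X, sampled G G l X &
      ints s' 2 0 = Posz (size X) /\ holds (reals s' 4) X).
Proof.
move=> s2 s4 G0 lW GlW hl GW.
apply: (@runs_time _ _ _ _ (1 + (size l * (10 * G + 40) + 1))); last by lia.
apply: (runs_seq (Q1 := fun s' => ints s' 3 0 = Posz G)).
  by apply: runs_straight; reads; rewrite s4; do !split.
by move=> s1 F1 s1_3; apply: runs_net_loop => //; framed.
Qed.

End Net.

(** * Selection *)

Definition rscalar a := RGet a (num 0).

Definition keep b :=
  Seq (assign 19 (num 0))
 (Seq (For 18 13
        (If b (Seq (RSet 5 (scalar 19) (RGet 6 (scalar 18))) (incr 19)) Skip))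
 (Seq (assign 13 (scalar 19)) (copy 6 5 13))).

Definition below_pivot := BNot (BRealLe (rscalar 10) (RGet 6 (scalar 18))).
Definition upto_pivot := BRealLe (RGet 6 (scalar 18)) (rscalar 10).

Definition pivot_step :=
  Seq (RSet 10 (num 0) (RGet 4 (scalar 15)))
 (Seq (Seq (assign 16 (num 0)) (For 18 13 (If below_pivot (incr 16) Skip)))
 (Seq (Seq (assign 17 (num 0)) (For 18 13 (If upto_pivot (incr 17) Skip)))
 (If (BNot (BIntLe (scalar 14) (scalar 17)))
    (Seq (keep (BNot upto_pivot))
         (assign 14 (ISub (scalar 14) (scalar 17))))
    (If (BIntLe (scalar 14) (scalar 16))
       (keep below_pivot)
       (Seq (RSet 9 (num 0) (rscalar 10)) (assign 13 (num 0))))))).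

Definition round :=
  Seq (assign 2 (scalar 13))
 (Seq (copy 4 6 13)
 (Seq (assign 4 (num 20))
 (Seq net (For 15 2 pivot_step)))).

Definition select := While (BIntLe (num 1) (scalar 13)) round.

(** The [r]-th smallest element, counted from 1 with multiplicity. The two counts are those that a
    pivot step computes. *)
Definition kth (R : realType) (l : seq R) (r : nat) (x : R) :=
  count (fun y => (y < x)%R) l < r <= count (fun y => (y <= x)%R) l.

Section Select.
Variables (R : realType) (W : nat).
Implicit Types (s : store R) (l : seq R).

(** The answer [y] lies above the pivot [x], so every discarded element is counted both below [y]
    and up to [y]; the rank drops by their number. *)
Lemma kth_above l r x y :
  kth [seq z <- l | ~~ (z <= x)%R] (r - count (fun z => (z <= x)%R) l) y ->
  count (fun z => (z <= x)%R) l < r -> kth l r y.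
Proof.
rewrite /kth => k_y lt_r.
have lt_xy : (x < y)%R.
  rewrite ltNge; apply/negP => le_yx; move: k_y.
  suff -> : count (fun z => (z <= y)%R) [seq z <- l | ~~ (z <= x)%R] = 0 by lia.
  rewrite count_filter (eq_count (a2 := pred0)) ?count_pred0 // => z /=.
  by apply/negP => /andP[/le_trans/(_ le_yx) ->].
have split_count (p : pred R) : (forall z, (z <= x)%R -> p z) ->
    count p l = count (fun z => (z <= x)%R) l +
                count p [seq z <- l | ~~ (z <= x)%R].
  move=> px; rewrite count_filter -count_predUI [X in _ + X](eq_count (a2 := pred0)).
    rewrite count_pred0 addn0; apply: eq_count => z /=.
    by case E: (z <= x)%R => /=; rewrite ?andbT // px.
  by move=> z /=; case: (z <= x)%R; rewrite ?andbF.
rewrite (split_count (fun z => (z < y)%R)); last first.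
  by move=> z /le_lt_trans; apply.
rewrite (split_count (fun z => (z <= y)%R)); first by rewrite -ltn_subRL -leq_subLR.
by move=> z /le_trans; apply; apply: ltW.
Qed.

(** If [x <= y], all remaining elements would be below [y], and the two counts in [kth] would
    coincide. So [y < x], and the discarded elements enter neither count. *)
Lemma kth_below l r x y :
  kth [seq z <- l | (z < x)%R] r y -> 0 < r -> kth l r y.
Proof.
rewrite /kth => k_y r_gt0.
have [z /andP[_ lt_zx] le_zy] : exists2 z, (z \in l) && (z < x)%R & (z <= y)%R.
  have : has (fun z => z <= y)%R [seq z <- l | (z < x)%R].
    by rewrite has_count; move: k_y; lia.
  by case/hasP => z; rewrite mem_filter andbC; exists z.
have [lt_yx|le_xy] := ltP y x; last first.
  have : count (fun z => (z < y)%R) [seq z <- l | (z < x)%R] =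
         size [seq z <- l | (z < x)%R].
    apply/eqP; rewrite -all_count; apply/allP => u; rewrite mem_filter => /andP[lt_ux _].
    exact: lt_le_trans lt_ux le_xy.
  move: k_y (count_size (fun z => (z <= y)%R) [seq z <- l | (z < x)%R]); lia.
have same (p : pred R) : (forall z, p z -> (z < x)%R) ->
    count p [seq z <- l | (z < x)%R] = count p l.
  move=> px; rewrite count_filter; apply: eq_count => u /=.
  by case E: (p u) => //=; apply: px.
move: k_y; rewrite !same //.
  by move=> u /le_lt_trans; apply.
by move=> u /lt_trans; apply.
Qed.

Lemma runs_keep s b l (p : pred R) :
  ints s 13 0 = Posz (size l) -> size l <= W -> holds (reals s 6) l ->
  (forall s' i, i < size l ->
     frame (For 18 13
        (If b (Seq (RSet 5 (scalar 19) (RGet 6 (scalar 18))) (incr 19)) Skip))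
       (iset s 19 0 0) s' ->
     ints s' 18 0 = Posz i ->
     bok W s' b /\ bv s' b = p (nth 0%R l i)) ->
  runs W (keep b) s (size l * 9 + 6) (fun s' =>
    ints s' 13 0 = Posz (size (filter p l)) /\ holds (reals s' 6) (filter p l)).
Proof.
move=> s13 lW hl okb.
apply: (@runs_time _ _ _ _ (1 + ((size l * (4 + 2) + 2) +
  (1 + (size l * 3 + 2))))); last by lia.
apply: (runs_seq (Q1 := eq (iset s 19 0 0))); first exact: runs_straight.
move=> s1 F1 eq_s1; subst s1.
have filterE : [seq nth 0%R l i | i <- iota 0 (size l) & p (nth 0%R l i)] = filter p l.
  by rewrite -[in RHS](mkseq_nth 0%R l) /mkseq filter_map.
apply: runs_seq.
  apply: (@runs_collect _ W _ 18 13 19 5 _ (size l) (fun i => p (nth 0%R l i))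
    (nth 0%R l) [::] 4) => //.
  move=> i s' v lt_i le_v F s'18 s'19; have [okb' vb] := okb s' i lt_i F s'18.
  apply: (@runs_straight _ _ (If b (Seq (RSet 5 (scalar 19) (RGet 6 (scalar 18)))
    (incr 19)) Skip)) => /=; split=> //; rewrite vb.
  case: (p _); reads; rewrite ?s'18 ?s'19 /=; last by rewrite addn0.
  do !split => //.
  - by rewrite add0n in le_v; lia.
  - by move=> _; rewrite upd_eq; framed; rewrite hl.
  - by move=> u lt_u; rewrite upd_neqi // neq_ltn lt_u.
rewrite /= filterE => s2 F2 [s2_19 h5].
have le_f : size (filter p l) <= size l by rewrite size_filter count_size.
apply: (runs_seq (Q1 := fun s' => ints s' 13 0 = Posz (size (filter p l)))).
  by apply: runs_straight; reads; rewrite s2_19; do !split.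
move=> s3 F3 s3_13; apply: (@runs_time _ _ _ _ (size (filter p l) * 3 + 2)); last by lia.
apply: runs_weaken (runs_copy _ _ s3_13 (leq_trans le_f lW) _) (leqnn _) _ => //.
  by framed.
move=> s4 F4 h6; split=> //; by framed.
Qed.

Lemma runs_pivot_step s l r q X :
  ints s 13 0 = Posz (size l) -> ints s 14 0 = Posz r -> ints s 15 0 = Posz q ->
  0 < r -> size l <= W -> r <= W -> holds (reals s 6) l -> holds (reals s 4) X ->
  q < size X ->
  let x := nth 0%R X q in
  runs W pivot_step s (size l * 20 + 20) (fun s' =>
    exists l' r', [/\ ints s' 13 0 = Posz (size l'), ints s' 14 0 = Posz r',
      holds (reals s' 6) l' &
      [\/ [/\ count (fun y => (y <= x)%R) l < r,
              r' = r - count (fun y => (y <= x)%R) l,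
              l' = [seq y <- l | ~~ (y <= x)%R] & reals s' 9 = reals s 9],
          [/\ r <= count (fun y => (y < x)%R) l, r' = r,
              l' = [seq y <- l | (y < x)%R] & reals s' 9 = reals s 9] |
          [/\ kth l r (reals s' 9 0), l' = [::] & r' = r]]]).
Proof.
move=> s13 s14 s15 r0 lW rW hl hX lt_q x.
set cle := count (fun y => (y <= x)%R) l.
set clt := count (fun y => (y < x)%R) l.
have cle_le : cle <= size l by apply: count_size.
apply: (@runs_time _ _ _ _ (1 + ((size l * 5 + 3) + ((size l * 5 + 3) +
  (size l * 9 + 7).+2)))); last by lia.
apply: (runs_seq (Q1 := fun s' => reals s' 10 0 = x)).
  by apply: runs_straight; reads; rewrite s15; do !split => //=; rewrite hX.
move=> s1 F1 s1_10.
apply: runs_seq.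
  apply: (@runs_count _ W s1 18 13 16 _ (size l) (fun i => nth 0 l i < x)%R) => //.
    by framed.
  move=> j s' lt_j F s'18 /=; rewrite s'18; split; first by do !split.
  by framed; rewrite s1_10 hl ?ltNge.
move=> s2 F2; rewrite -(count_nth_iota l (fun y => (y < x)%R)) => s2_16.
have s2_10 : reals s2 10 0 = x by framed.
apply: runs_seq.
  apply: (@runs_count _ W s2 18 13 17 _ (size l) (fun i => nth 0 l i <= x)%R) => //.
    by framed.
  move=> j s' lt_j F s'18 /=; rewrite s'18; split; first by do !split.
  by framed; rewrite s1_10 hl.
move=> s3 F3; rewrite -(count_nth_iota l (fun y => (y <= x)%R)) => s3_17.
rewrite -/cle in s3_17.
have s3_10 : reals s3 10 0 = x by framed.
have s3_14 : ints s3 14 0 = Posz r by framed.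
have s3_16 : ints s3 16 0 = Posz clt by framed.
have s3_13 : ints s3 13 0 = Posz (size l) by framed.
have s3_9 : reals s3 9 = reals s 9 by framed.
apply: runs_if; first by rewrite /= s3_14 s3_17.
rewrite /= s3_14 s3_17 /= -ltnNge; case: ltnP => [lt_r|le_r].
  apply: (@runs_time _ _ _ _ ((size l * 9 + 6) + 1)); last by lia.
  apply: runs_seq.
    apply: (runs_keep (l := l) (p := fun y => ~~ (y <= x)%R)) => //; first by framed.
    move=> s' i lt_i F s'18 /=; rewrite s'18; split; first by do !split.
    by framed; rewrite s1_10 hl.
  move=> s4 F4 [s4_13 h4]; apply: runs_straight; reads.
  have -> : ints s4 14 0 = Posz r by framed.
  have -> : ints s4 17 0 = Posz cle by framed.
  rewrite /=; split=> //; first by do !split => //; lia.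
  exists [seq y <- l | ~~ (y <= x)%R], (r - cle); split=> //.
  by apply: Or31; split=> //; framed.
apply: runs_if; first by rewrite /= s3_14 s3_16.
rewrite /= s3_14 s3_16 /=; case: leqP => [le_rc|lt_cr].
  apply: (@runs_time _ _ _ _ (size l * 9 + 6)); last by lia.
  apply: runs_weaken (runs_keep (l := l) (p := fun y => (y < x)%R) _ _ _ _)
    (leqnn _) _ => //; first by framed.
    move=> s' i lt_i F s'18 /=; rewrite s'18; split; first by do !split.
    by framed; rewrite s1_10 hl ?ltNge.
  move=> s4 F4 [s4_13 h4].
  exists [seq y <- l | (y < x)%R], r; split=> //; first by framed.
  by apply: Or32; split=> //; framed.
apply: (@runs_time _ _ _ _ 2); last by lia.
apply: runs_straight; reads; do !split => //.
by exists [::], r; split=> //; apply: Or33; split=> //; rewrite /kth s3_10 lt_cr.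
Qed.

(** Every element of a net with [G = 20] serves as a pivot. Unless one of them is the answer, the
    survivors lie in an interval that avoids the net, and [10 / 20] is the halving factor. The word
    bound comes from the net, which needs [2 * 20 * size l]. *)
Lemma runs_round s l r :
  ints s 13 0 = Posz (size l) -> ints s 14 0 = Posz r ->
  0 < r <= size l -> 40 * size l + 20 <= W -> holds (reals s 6) l ->
  runs W round s (size l * 1100) (fun s' =>
    exists l' r', [/\ ints s' 13 0 = Posz (size l'), ints s' 14 0 = Posz r',
      holds (reals s' 6) l' &
      (l' = [::] /\ kth l r (reals s' 9 0)) \/
      [/\ 0 < r' <= size l', 2 * size l' <= size l &
          forall x, kth l' r' x -> kth l r x]]).
Proof.
move=> s13 s14 /andP[r0 rl] lW hl.
have lW' : size l <= W by lia.
apply: (@runs_time _ _ _ _ (1 + ((size l * 3 + 2) + (1 +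
  ((size l * (10 * 20 + 40) + 2) + (20 * (size l * 20 + 20 + 2) + 2)))))); last by lia.
apply: (runs_seq (Q1 := fun s' => ints s' 2 0 = Posz (size l))).
  by apply: runs_straight; reads; rewrite s13; do !split.
move=> s1 F1 s1_2.
apply: runs_seq.
  by apply: (runs_copy (l := l)) => //; framed.
move=> s2 F2 h2_4.
apply: (runs_seq (Q1 := fun s' => ints s' 4 0 = Posz 20)).
  by apply: runs_straight; reads; do !split.
move=> s3 F3 s3_4.
apply: runs_seq.
  apply: (runs_net (l := l) (G := 20)) => //; first by framed.
  - by lia.
  - by framed.
  - by lia.
move=> s4 F4 [X sX [s4_2 hX]].
have size_X := size_sampled sX.
apply: (@runs_time _ _ _ _ (size X * (size l * 20 + 20 + 2) + 2)); last first.
  by rewrite leq_add2r leq_mul2r size_X orbT.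
(* Either a pivot was the answer and no candidate is left, or the candidates are the part of [l] in
   an interval [P] that avoids the first [j] pivots. *)
pose I j s' := exists l' r', [/\ ints s' 13 0 = Posz (size l'),
  ints s' 14 0 = Posz r', holds (reals s' 6) l', 0 < r' <= r &
  (l' = [::] /\ kth l r (reals s' 9 0)) \/
  [/\ r' <= size l', forall x, kth l' r' x -> kth l r x &
     exists P : pred R, [/\ convex_pred P, l' = filter P l &
       forall i, i < j -> ~~ P (nth 0%R X i)]]].
have size_filter_le (p : pred R) : size (filter p l) <= size l.
  by rewrite size_filter count_size.
apply: runs_weaken (runs_for (I := I) _ _ s4_2 _ _ _) (leqnn _) _ => //.
- by lia.
- exists l, r; split.
  + by reads; framed.
  + by reads; framed.
  + by reads; framed.
  + by rewrite r0 leqnn.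
  right; split=> //; exists predT; split=> //.
  by rewrite filter_predT.
- move=> j s5 lt_j F5 s5_15 [l1 [r1 [s5_13 s5_14 h5 /andP[r1_gt0 r1_le] alt]]].
  have le_l1 : size l1 <= size l.
    by case: alt => [[-> _]//|[_ _ [P [_ -> _]]]].
  apply: (@runs_time _ _ _ _ (size l1 * 20 + 20)); last by lia.
  apply: runs_weaken (runs_pivot_step s5_13 s5_14 s5_15 r1_gt0 _ _ h5 _ lt_j)
    (leqnn _) _; [by lia | by lia | by framed | ].
  set x := nth 0%R X j.
  move=> s6 F6 [l2 [r2 [s6_13 s6_14 h6 step]]].
  exists l2, r2; split; [by reads | by reads | by [] | | ].
    by case: step => [[lt_r -> _ _]|[_ -> _ _]|[_ _ ->]]; lia.
  case: step => [[lt_r er el e9]|[le_r er el e9]|[kx -> _]].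
  + case: alt => [[l1_nil kd]|[r1l kl [P [cP lP nP]]]].
      by left; rewrite el l1_nil /= e9.
    right; split.
    * rewrite er el size_filter leq_subLR.
      by rewrite (count_predC (fun y => (y <= x)%R) l1 : _ + _ = _).
    * by move=> y; rewrite er el => /kth_above /(_ lt_r) /kl.
    exists (fun y => ~~ (y <= x)%R && P y); split.
    * move=> a b c /andP[ab bc] /andP[nax Pa] /andP[ncx Pc].
      rewrite (cP a b c) ?ab // andbT.
      by apply: contra nax => /(le_trans ab).
    * by rewrite el lP filter_predI.
    * move=> i; rewrite ltnS leq_eqVlt => /orP[/eqP ->|/nP /negbTE ->].
        by rewrite lexx.
      by rewrite andbF.
  + case: alt => [[l1_nil kd]|[r1l kl [P [cP lP nP]]]].
      by move: le_r; rewrite l1_nil /=; lia.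
    right; split.
    * by rewrite er el size_filter.
    * by move=> y; rewrite er el => /kth_below /(_ r1_gt0) /kl.
    exists (fun y => (y < x)%R && P y); split.
    * move=> a b c /andP[ab bc] /andP[nax Pa] /andP[ncx Pc].
      by rewrite (cP a b c) ?ab // andbT (le_lt_trans bc).
    * by rewrite el lP filter_predI.
    * move=> i; rewrite ltnS leq_eqVlt => /orP[/eqP ->|/nP /negbTE ->].
        by rewrite ltxx.
      by rewrite andbF.
  + left; split=> //; case: alt => [[l1_nil _]|[_ kl _]]; last exact: kl.
    by move: kx; rewrite l1_nil /kth /=; lia.
move=> s5 F5 [l1 [r1 [s5_13 s5_14 h5 /andP[r1_gt0 r1_le] alt]]].
exists l1, r1; split=> //; case: alt => [alt|[r1l kl [P [cP lP nP]]]]; first by left.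
right; split=> //; first by rewrite r1_gt0.
have nPX : ~~ has P X.
  by apply/negP => /(has_nthP 0%R)[i /nP /negbTE ->].
have [//|| ] := sampled_net _ cP sX nPX; rewrite -size_filter -lP; lia.
Qed.

(** The rounds form a geometric series with ratio one half and first term [1100 * size l]. *)
Lemma runs_select s l r :
  ints s 13 0 = Posz (size l) -> ints s 14 0 = Posz r ->
  0 < r <= size l -> 40 * size l + 20 <= W -> holds (reals s 6) l ->
  runs W select s (size l * 2300 + 1) (fun s' => kth l r (reals s' 9 0)).
Proof.
move: {2}(size l) (leqnn (size l)) => b.
elim: b s l r => [|b IH] s l r le_b s13 s14 rl lW hl; first by lia.
apply: runs_time.
  apply: runs_while_loop.
  - by rewrite /= s13.
  - by rewrite /= s13 /=; lia.
  - exact: runs_round s13 s14 rl lW hl.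
  move=> s1 F1 [l1 [r1 [s1_13 s1_14 h1 alt]]].
  apply: (runs_time (T := size l * 1150 + 1)); last exact: leqnn.
  case: alt => [[l1_nil kx]|[r1_l1 le_l1 kl]].
    apply: (@runs_time _ _ _ _ 1); last by lia.
    by apply: runs_while_end => //=; rewrite s1_13 // l1_nil.
  apply: runs_weaken (IH s1 l1 r1 _ s1_13 s1_14 r1_l1 _ h1) _ _.
  - by lia.
  - by lia.
  - by lia.
  by move=> s2 _ /kl.
by lia.
Qed.

End Select.

(** * Enclosing squares *)

Lemma count_sub_in (T : eqType) (a1 a2 : pred T) (s : seq T) :
  {in s, forall x, a1 x -> a2 x} -> count a1 s <= count a2 s.
Proof.
elim: s => //= x s IH sub12; apply: leq_add.
  by have := sub12 x (mem_head _ _); case: (a1 x) => // ->.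
by apply: IH => y ys; apply: sub12; rewrite inE ys orbT.
Qed.

Section Geometry.
Variable R : realType.
Local Open Scope ring_scope.
Implicit Types (pts : seq (R * R)) (Q : square R) (v p : R * R) (rho : R).

Lemma ex_min_seq (T : eqType) (f : T -> R) (E : seq T) : E != [::] ->
  exists2 p, p \in E & forall q, q \in E -> f p <= f q.
Proof.
elim: E => // p [|q E] IH _.
  by exists p; rewrite ?mem_head // => q; rewrite inE => /eqP ->.
have [//|m mE min_m] := IH.
have [le_pm|lt_mp] := leP (f p) (f m).
  exists p; rewrite ?mem_head // => u; rewrite inE => /orP[/eqP ->//|/min_m].
  exact: le_trans.
exists m; first by rewrite inE mE orbT.
by move=> u; rewrite inE => /orP[/eqP ->|/min_m //]; apply: ltW.
Qed.

(** A k-enclosing square shrinks to one fitted to the bounding box of its points, whose side is a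
    difference of two abscissas or of two ordinates. So finitely many sides compete; which of them
    are attained is decided classically. *)
Lemma smallest_k_enclosing_exists pts k Q0 : (0 < k)%N ->
  k_enclosing pts k Q0 -> exists Q, smallest_k_enclosing pts k Q.
Proof.
move=> k_gt0 kQ0.
pose D := [seq p.1 - q.1 | p <- pts, q <- pts] ++
          [seq p.2 - q.2 | p <- pts, q <- pts].
pose A d := exists2 Q, k_enclosing pts k Q & side Q = d.
have shrink Q : k_enclosing pts k Q ->
    exists d, [/\ d \in D, A d & d <= side Q].
  move=> [Q_ge0 kQ]; pose E := filter (encloses Q) pts.
  have E0 : E != [::] by rewrite -size_eq0 size_filter -lt0n (leq_trans k_gt0).
  have inE p : p \in E -> encloses Q p /\ p \in pts.
    by rewrite mem_filter => /andP[].
  have [p1 p1E min1] := ex_min_seq (fun p => p.1) E0.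
  have [q1 q1E max1] := ex_min_seq (fun p => - p.1) E0.
  have [p2 p2E min2] := ex_min_seq (fun p => p.2) E0.
  have [q2 q2E max2] := ex_min_seq (fun p => - p.2) E0.
  have [/andP[Qp1 _] p1s] := inE _ p1E; have [/andP[Qq1 _] q1s] := inE _ q1E.
  have [/andP[_ Qp2] p2s] := inE _ p2E; have [/andP[_ Qq2] q2s] := inE _ q2E.
  pose d := Num.max (q1.1 - p1.1) (q2.2 - p2.2).
  have d1 : q1.1 - p1.1 <= d by rewrite le_max lexx.
  have d2 : q2.2 - p2.2 <= d by rewrite le_max lexx orbT.
  exists d; split.
  - rewrite /d mem_cat maxEle; case: ifP => _; apply/orP.
      by right; apply/allpairsP; exists (q2, p2).
    by left; apply/allpairsP; exists (q1, p1).
  - exists (Square (p1.1, p2.2) d) => //; split=> /=.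
      by apply: le_trans d1; have := min1 _ q1E; rewrite subr_ge0.
    apply: leq_trans kQ _; apply: count_sub_in => p p_in Qp.
    have pE : p \in E by rewrite mem_filter Qp.
    move: (min1 _ pE) (max1 _ pE) (min2 _ pE) (max2 _ pE).
    rewrite !lerN2 /encloses /= => l1 l2 l3 l4; rewrite l1 l3 /=.
    by apply/andP; split; lra.
  - rewrite ge_max; move: Qp1 Qq1 Qp2 Qq2 => /andP[? ?] /andP[? ?] /andP[? ?] /andP[? ?].
    by apply/andP; split; lra.
pose D' := [seq d <- D | `[< A d >]].
have [d0 [d0D Ad0 _]] := shrink Q0 kQ0.
have D'0 : D' != [::].
  apply: contraTneq isT => D'_nil; have : d0 \in D'.
    by rewrite mem_filter d0D andbT; apply/asboolP.
  by rewrite D'_nil.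
have [d] := ex_min_seq id D'0; rewrite mem_filter => /andP[/asboolP[Q kQ Qd] _] min_d.
exists Q; split=> // Q' /shrink[e [eD Ae le_e]]; apply: le_trans le_e.
by rewrite Qd; apply: min_d; rewrite mem_filter eD andbT; apply/asboolP.
Qed.

(** A square of side 0 is a single point and contains at most one of the distinct points. This makes
    the least radius positive. *)
Lemma k_enclosing_side_gt0 pts k Q : uniq pts -> (1 < k)%N ->
  k_enclosing pts k Q -> 0 < side Q.
Proof.
move=> uniq_pts k_gt1 [Q_ge0 kQ]; rewrite lt_neqAle Q_ge0 andbT.
apply/eqP => side0.
have : (count (encloses Q) pts <= 1)%N.
  rewrite (leq_trans _ (leq_b1 (corner Q \in pts))) // -count_uniq_mem //.
  apply: sub_count => -[x y]; rewrite /encloses -side0 !addr0 /=.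
  move=> /andP[/le_anti <- /le_anti <-].
  by case: (corner Q) => a b /=.
by move=> le1; move: (leq_trans kQ le1); rewrite leqNgt k_gt1.
Qed.

(** Distance in the maximum norm, nested in the order in which [distances] raises the stored
    value. *)
Definition dist v p : R :=
  Num.max (Num.max (Num.max (p.1 - v.1) (v.1 - p.1)) (p.2 - v.2)) (v.2 - p.2).

Definition ball v rho : square R := Square (v.1 - rho, v.2 - rho) (2 * rho).

Lemma dist_le v p rho : (dist v p <= rho) = encloses (ball v rho) p.
Proof.
rewrite /dist /encloses /= !ge_max.
apply/idP/idP => [/andP[/andP[/andP[? ?] ?] ?]|/andP[/andP[? ?] /andP[? ?]]].
  by do !(apply/andP; split); lra.
by do !(apply/andP; split); lra.
Qed.

Lemma dist_ge0 v p : 0 <= dist v p.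
Proof.
by rewrite /dist !le_max !subr_ge0; case: leP => //= /ltW ->.
Qed.

Definition net_for k (xs X : seq R) :=
  forall P : pred R, convex_pred P -> (k <= count P xs)%N -> has P X.

Lemma enclosed_vertex pts k X Y Q :
  net_for k [seq p.1 | p <- pts] X -> net_for k [seq p.2 | p <- pts] Y ->
  k_enclosing pts k Q ->
  exists a b, [/\ (a < size X)%N, (b < size Y)%N &
    encloses Q (nth 0 X a, nth 0 Y b)].
Proof.
move=> netX netY [_ kQ].
have cvx (l h : R) : convex_pred (fun x => l <= x <= h).
  move=> x y z /andP[xy yz] /andP[lx _] /andP[_ zh].
  by rewrite (le_trans lx) // (le_trans yz).
have /(has_nthP 0)[a lt_a Qa] := netX _ (cvx (corner Q).1 ((corner Q).1 + side Q)) ltac:(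
  by rewrite count_map; apply: leq_trans kQ (sub_count _ _) => p /andP[]).
have /(has_nthP 0)[b lt_b Qb] := netY _ (cvx (corner Q).2 ((corner Q).2 + side Q)) ltac:(
  by rewrite count_map; apply: leq_trans kQ (sub_count _ _) => p /andP[]).
by exists a, b; split=> //; rewrite /encloses Qa.
Qed.

Lemma encloses_dist Q v p : encloses Q v -> encloses Q p -> dist v p <= side Q.
Proof.
rewrite dist_le /encloses /= => /andP[/andP[? ?] /andP[? ?]] /andP[/andP[? ?] /andP[? ?]].
by do !(apply/andP; split); lra.
Qed.

(** The [k] points of [Q] are all within [side Q] of any point [v] of [Q]; applied to an optimal
    square and a vertex in it. *)
Lemma kth_dist_le pts k Q v rho : k_enclosing pts k Q -> encloses Q v ->
  kth [seq dist v p | p <- pts] k rho -> rho <= side Q.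
Proof.
move=> [_ kQ] Qv /andP[lt_k _]; rewrite leNgt; apply/negP => lt_side.
move: lt_k; rewrite ltnNge; apply/negP/negPn; apply: leq_trans kQ _.
rewrite count_map; apply: sub_count => p Qp /=.
exact: le_lt_trans (encloses_dist Qv Qp) lt_side.
Qed.

Lemma kth_dist_ge0 pts k v rho : (0 < k)%N ->
  kth [seq dist v p | p <- pts] k rho -> 0 <= rho.
Proof.
move=> k_gt0 /andP[_ le_k]; have : has (fun y => y <= rho) [seq dist v p | p <- pts].
  by rewrite has_count (leq_trans k_gt0).
by case/hasP => _ /mapP[p _ ->]; apply: le_trans; apply: dist_ge0.
Qed.

Lemma kth_ball pts k v rho : (0 < k)%N ->
  kth [seq dist v p | p <- pts] k rho -> k_enclosing pts k (ball v rho).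
Proof.
move=> k_gt0 kr; split; first by rewrite mulr_ge0 ?(kth_dist_ge0 k_gt0 kr).
move: kr => /andP[_]; rewrite count_map => /leq_trans; apply.
by apply: sub_count => p /=; rewrite dist_le.
Qed.

End Geometry.

(** * The constant-factor approximation *)

Definition coordinate_net (ord : bool) :=
  Seq (assign 4 (IMul (num 10) (IAdd (idiv (scalar 0) (scalar 1)) (num 1))))
 (Seq (assign 2 (scalar 0))
 (Seq (copy 4 (if ord then 1 else 0) 2)
 (Seq net
 (Seq (assign (if ord then 21 else 20) (scalar 2))
      (copy (if ord then 8 else 7) 4 2))))).

Definition vertex :=
  Seq (assign 23 (idiv (scalar 22) (scalar 21)))
 (Seq (RSet 13 (num 0) (RGet 7 (scalar 23)))
      (RSet 14 (num 0)
         (RGet 8 (ISub (scalar 22) (IMul (scalar 23) (scalar 21)))))).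

Definition raise_to e :=
  If (BRealLe (RGet 6 (scalar 18)) e) (RSet 6 (scalar 18) e) Skip.

Definition distances :=
  For 18 0 (Seq (RSet 6 (scalar 18) (RSub (RGet 0 (scalar 18)) (rscalar 13)))
           (Seq (raise_to (RSub (rscalar 13) (RGet 0 (scalar 18))))
           (Seq (raise_to (RSub (RGet 1 (scalar 18)) (rscalar 14)))
                (raise_to (RSub (rscalar 14) (RGet 1 (scalar 18))))))).

(** At vertex 0 real cell 12 still holds an arbitrary value, so the comparison with it takes effect
    only from vertex 1 on. *)
Definition vertex_radius :=
  Seq vertex
 (Seq distances
 (Seq (Seq (assign 13 (scalar 0)) (assign 14 (scalar 1)))
 (Seq select
      (If (BNot (BAnd (BIntLe (num 1) (scalar 22))
                      (BRealLe (rscalar 12) (rscalar 9))))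
          (RSet 12 (num 0) (rscalar 9)) Skip)))).

Definition min_radius :=
  Seq (assign 24 (IMul (scalar 20) (scalar 21))) (For 22 24 vertex_radius).

Section Radius.
Variables (R : realType) (W : nat).
Implicit Types (s : store R) (pts : seq (R * R)).

Definition net_size n k := 10 * (n %/ k).+1.

Lemma net_size_gt0 n k : 0 < net_size n k.
Proof. by rewrite /net_size muln_gt0. Qed.

(** This fixes [net_size]: an interval with [k] elements missed by the net would give
    [k * (n %/ k).+1 <= n], which is false. *)
Lemma sampled_net_for (xs X : seq R) k : 0 < k ->
  sampled (net_size (size xs) k) (net_size (size xs) k) xs X ->
  net_for k xs X.
Proof.
move=> k_gt0 sX P cP kP; apply/negPn/negP => nPX.
have [|] := sampled_net (net_size_gt0 _ _) cP sX nPX; rewrite /net_size.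
  by move=> c0; move: kP; rewrite c0 leqNgt k_gt0.
have := ltn_ceil (size xs) k_gt0.
have : (count P xs).+1 * (size xs %/ k).+1 >= k * (size xs %/ k).+1.
  by rewrite leq_mul2r (leq_trans kP) ?orbT.
by lia.
Qed.

Lemma runs_coordinate_net s (ord : bool) xs k :
  let m := if ord then 21 else 20 in let d := if ord then 8 else 7 in
  ints s 0 0 = Posz (size xs) -> ints s 1 0 = Posz k ->
  holds (reals s (if ord then 1 else 0)) xs ->
  0 < k <= size xs -> 2 * net_size (size xs) k * (size xs).+1 <= W ->
  runs W (coordinate_net ord) s (size xs * (10 * net_size (size xs) k + 50) + 10)
    (fun s' => exists X, [/\ ints s' m 0 = Posz (size X), holds (reals s' d) X,
       size X <= net_size (size xs) k & net_for k xs X]).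
Proof.
move=> m d s0 s1 hx /andP[k_gt0 le_k] le_W.
set G := net_size _ _ in le_W *.
have G_gt0 : 0 < G by apply: net_size_gt0.
have nW : size xs < W by nia.
apply: (@runs_time _ _ _ _ (1 + (1 + ((size xs * 3 + 2) +
  ((size xs * (10 * G + 40) + 2) + (1 + (size xs * 3 + 2))))))); last by lia.
apply: (runs_seq (Q1 := fun s' => ints s' 4 0 = Posz G)).
  apply: runs_straight; reads; rewrite s0 s1 /= truncn_div //.
  have le_G : G <= W by nia.
  move: le_G; rewrite /G /net_size -addn1; set q := size xs %/ k => le_G.
  by do !split => //; rewrite ?pnatr_eq0 -?lt0n ?divr_ge0 ?ler0n //; lia.
move=> s2 F2 s2_4.
have s2_0 : ints s2 0 0 = Posz (size xs).
  by case: ord @m @d F2 hx => m d F2 hx; framed.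
apply: (runs_seq (Q1 := fun s' => ints s' 2 0 = Posz (size xs))).
  by apply: runs_straight; reads; rewrite s2_0; do !split.
move=> s3 F3 s3_2.
apply: (runs_seq (Q1 := fun s' => holds (reals s' 4) xs)).
  apply: runs_copy => //; [by case: ord @m @d F2 hx | by lia | ].
  by case: ord @m @d F2 hx => m d F2 hx; framed.
move=> s4 F4 h4.
apply: runs_seq.
  apply: (runs_net (l := xs) (G := G)) => //.
  - by case: ord @m @d F2 F4 hx => m d F2 F4 hx; framed.
  - by case: ord @m @d F2 F4 hx => m d F2 F4 hx; framed.
  - by lia.
  - by nia.
  - by nia.
move=> s5 F5 [X sX [s5_2 hX]].
have le_X := size_sampled sX.
have le_Xxs : size X <= size xs.
  elim: sX {s5_2 hX le_X} => // g l t {}X _ /size_thinned le_t _; lia.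
apply: (runs_seq (Q1 := fun s' => ints s' m 0 = Posz (size X))).
  rewrite /m; case: ord @m @d F2 F4 hx => m d F2 F4 hx;
  by apply: runs_straight; reads; rewrite s5_2; do !split.
move=> s6 F6 s6_m.
apply: (@runs_time _ _ _ _ (size X * 3 + 2)); last by lia.
apply: runs_weaken (runs_copy (l := X) _ _ _ _ _) (leqnn _) _.
- by rewrite /d; case: ord @m @d F2 F4 hx s6_m F6.
- by [].
- by case: ord @m @d F2 F4 hx s6_m F6 => m d F2 F4 hx s6_m F6; framed.
- by lia.
- by case: ord @m @d F2 F4 hx s6_m F6 => m d F2 F4 hx s6_m F6; framed.
move=> s7 F7 h7; exists X; split=> //; last exact: sampled_net_for.
by rewrite /m /d in h7 *; case: ord @m @d F2 F4 hx s6_m F6 F7 h7 => m d F2 F4 hx s6_m F6 F7 h7; framed.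
Qed.

Definition vert (X Y : seq R) t : R * R :=
  (nth 0%R X (t %/ size Y), nth 0%R Y (t %% size Y)).

Lemma runs_vertex s X Y t :
  ints s 22 0 = Posz t -> ints s 21 0 = Posz (size Y) -> t < size X * size Y ->
  t <= W -> holds (reals s 7) X -> holds (reals s 8) Y ->
  runs W vertex s 3 (fun s' =>
    reals s' 13 0 = (vert X Y t).1 /\ reals s' 14 0 = (vert X Y t).2).
Proof.
move=> s22 s21 lt_t tW hX hY; have Y_gt0 : 0 < size Y by case: (size Y) lt_t; lia.
apply: runs_straight; reads; rewrite s22 s21 /= truncn_div //.
have le_t := leq_trunc_div t (size Y).
have -> : t - t %/ size Y * size Y = t %% size Y.
  by rewrite {1}(divn_eq t (size Y)) addKn.
rewrite hX ?hY ?ltn_mod // ?ltn_divLR //.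
have := leq_mod t (size Y); have := leq_div t (size Y).
by do !split => //; rewrite ?pnatr_eq0 -?lt0n ?divr_ge0 ?ler0n //; lia.
Qed.

Lemma runs_distances s pts v :
  ints s 0 0 = Posz (size pts) -> size pts <= W ->
  holds (reals s 0) [seq p.1 | p <- pts] ->
  holds (reals s 1) [seq p.2 | p <- pts] ->
  reals s 13 0 = v.1 -> reals s 14 0 = v.2 ->
  runs W distances s (size pts * 15 + 2) (fun s' =>
    holds (reals s' 6) [seq dist v p | p <- pts]).
Proof.
move=> s0 nW hx hy s13 s14.
apply: (@runs_time _ _ _ _ (size pts * (10 + 2) + 2)); last by lia.
pose I j s' := forall i, i < j -> reals s' 6 i = dist v (nth 0%R pts i).
apply: runs_weaken (runs_for (I := I) (B := 10) _ _ s0 nW _ _) (leqnn _) _ => //.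
  move=> j s' lt_j F s'18 Ij; apply: runs_straight => /=.
  have x_j : reals s' 0 j = (nth 0%R pts j).1.
    by framed; rewrite hx ?size_map // (nth_map 0%R).
  have y_j : reals s' 1 j = (nth 0%R pts j).2.
    by framed; rewrite hy ?size_map // (nth_map 0%R).
  have v_1 : reals s' 13 0 = v.1 by framed.
  have v_2 : reals s' 14 0 = v.2 by framed.
  have fin (s2 : store R) : reals s2 6 j = dist v (nth 0%R pts j) ->
      (forall i, i < j -> reals s2 6 i = reals s' 6 i) -> I j.+1 (iset s2 18 0 j.+1).
    move=> s2j s2i i; rewrite ltnS leq_eqVlt => /orP[/eqP ->//|lt_ij].
    by rewrite /= s2i // Ij.
  move: fin; rewrite /dist !maxEle; reads; rewrite s'18 /=; reads.
  rewrite x_j y_j v_1 v_2 => fin.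
  have keep_i (m : nat -> nat -> R) x i : i < j -> upd m 6 j x 6 i = m 6 i.
    by move=> lt_ij; rewrite upd_neqi // neq_ltn lt_ij.
  split=> //; split; first by do !split.
  do 3 (match goal with |- context [if ?c then _ else _] =>
    case: c fin => fin end; do ?split => //);
  by apply: fin => /=; reads => // i lt_ij; rewrite !keep_i.
move=> s' F Is' i; rewrite size_map => lt_i.
by rewrite Is' // (nth_map 0%R).
Qed.

Definition is_min_radius X Y pts k T (r0 : R) :=
  (exists2 t, t < T & kth [seq dist (vert X Y t) p | p <- pts] k r0) /\
  (forall t, t < T -> exists2 rho,
     kth [seq dist (vert X Y t) p | p <- pts] k rho & (r0 <= rho)%R).

(** [T = 0] is the state before any vertex, when [r0] is arbitrary; the conditional is the test in
    [vertex_radius]. *)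
Lemma is_min_radiusS X Y pts k T r0 rho :
  T = 0 \/ is_min_radius X Y pts k T r0 ->
  kth [seq dist (vert X Y T) p | p <- pts] k rho ->
  is_min_radius X Y pts k T.+1 (if (0 < T) && (r0 <= rho)%R then r0 else rho).
Proof.
move=> min_r k_rho; case: ifP => [/andP[T_gt0 le_r0]|not_le].
  have [T0|[[t lt_t k_r0] min_T]] := min_r; first by rewrite T0 in T_gt0.
  split; first by exists t => //; apply: ltnW.
  move=> u; rewrite ltnS leq_eqVlt => /orP[/eqP ->|/min_T //].
  by exists rho.
split; first by exists T.
move=> u; rewrite ltnS leq_eqVlt => /orP[/eqP ->|lt_u]; first by exists rho.
have [T0|[_ min_T]] := min_r; first by rewrite T0 in lt_u.
have [rho' k_rho' le_rho'] := min_T u lt_u; exists rho' => //.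
apply: le_trans le_rho'; apply: ltW; rewrite ltNge; apply/negP => le_r0.
by move: not_le; rewrite le_r0 (leq_ltn_trans (leq0n u) lt_u).
Qed.

Lemma runs_min_radius s pts k X Y :
  ints s 0 0 = Posz (size pts) -> ints s 1 0 = Posz k ->
  0 < k <= size pts -> 40 * size pts + 20 <= W ->
  holds (reals s 0) [seq p.1 | p <- pts] ->
  holds (reals s 1) [seq p.2 | p <- pts] ->
  ints s 20 0 = Posz (size X) -> ints s 21 0 = Posz (size Y) ->
  holds (reals s 7) X -> holds (reals s 8) Y -> size X * size Y <= W ->
  0 < size X * size Y ->
  runs W min_radius s (size X * size Y * (size pts * 2315 + 20) + 3) (fun s' =>
    ints s' 24 0 = Posz (size X * size Y) /\
    is_min_radius X Y pts k (size X * size Y) (reals s' 12 0)).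
Proof.
move=> s0 s1 /andP[k_gt0 le_k] le_W hx hy s20 s21 hX hY TW T_gt0.
set T := size X * size Y in TW T_gt0 *.
apply: (@runs_time _ _ _ _ (1 + (T * (size pts * 2315 + 18 + 2) + 2))); last by lia.
apply: (runs_seq (Q1 := fun s' => ints s' 24 0 = Posz T)).
  by apply: runs_straight; reads; rewrite s20 s21 /=; do !split.
move=> s2 F2 s2_24.
pose I j s' := j = 0 \/ is_min_radius X Y pts k j (reals s' 12 0).
apply: runs_weaken (runs_for (I := I) (B := size pts * 2315 + 18) _ _ s2_24 TW _ _)
  (leqnn _) _ => //; last first.
- move=> s3 F3 [T0|min_T]; first by rewrite T0 in T_gt0.
  by split=> //; framed.
- move=> j s3 lt_j F3 s3_22 Ij.
  apply: (@runs_time _ _ _ _ (3 + ((size pts * 15 + 2) + (2 +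
    ((size pts * 2300 + 1) + 3))))); last by lia.
  apply: runs_seq.
    apply: (runs_vertex (X := X) (Y := Y) (t := j)) => //; last first.
    + by framed.
    + by framed.
    + by lia.
    by framed.
  move=> s4 F4 [s4_13 s4_14].
  apply: runs_seq.
    apply: (runs_distances (pts := pts) _ _ _ _ s4_13 s4_14); [by framed | by lia | by framed | by framed].
  move=> s5 F5 h5.
  apply: (runs_seq (Q1 := fun s' => ints s' 13 0 = Posz (size pts) /\
      ints s' 14 0 = Posz k)).
    apply: runs_straight; reads.
    have -> : ints s5 0 0 = Posz (size pts) by framed.
    have -> : ints s5 1 0 = Posz k by framed.
    by do !split.
  move=> s6 F6 [s6_13 s6_14].
  apply: runs_seq.
    have := @runs_select R W s6 [seq dist (vert X Y j) p | p <- pts] k.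
    by rewrite size_map k_gt0 le_k; apply => //; framed.
  move=> s7 F7 k_rho; apply: runs_straight => /=; reads.
  have -> : ints s7 22 0 = Posz j by framed.
  have r0E : reals s7 12 = reals s3 12 by framed.
  have min_j := is_min_radiusS Ij k_rho.
  split; first by do !split.
  move: min_j; rewrite r0E /=; case: ifP => //= _ min_j;
    (do ?split => //); right; reads => //.
  by rewrite r0E.
by left.
Qed.

End Radius.

(** * Blocks of grid cells *)

Section Quadrants.
Implicit Types (C : seq (nat * nat)) (a b : nat).

(** The two-dimensional prefix sum. [C] lists one cell per point, so multiplicities count. *)
Definition quadrant C a b := count (fun c => (c.1 < a) && (c.2 < b)) C.

Definition block C i j len :=
  count (fun c => (i <= c.1 < i + len) && (j <= c.2 < j + len)) C.

Lemma quadrant0l C b : quadrant C 0 b = 0.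
Proof. exact: count_pred0. Qed.

Lemma quadrant0r C a : quadrant C a 0 = 0.
Proof.
by rewrite /quadrant (eq_count (a2 := pred0)) ?count_pred0 // => c; rewrite andbF.
Qed.

Lemma quadrant_rectangle C a b a' b' : a <= a' -> b <= b' ->
  quadrant C a' b' + quadrant C a b = quadrant C a b' + quadrant C a' b +
    count (fun c => (a <= c.1 < a') && (b <= c.2 < b')) C.
Proof.
move=> le_a le_b; rewrite /quadrant; elim: C => //= -[x y] C IH /=; lia.
Qed.

(** The recurrence that fills the table. A cell is stored at [c.1 * M + c.2], a code that is
    injective because second coordinates are below [M]. *)
Lemma quadrant_cell C M a b :
  b < M -> (forall c, c \in C -> c.2 < M) ->
  quadrant C a.+1 b.+1 + quadrant C a b = quadrant C a b.+1 + quadrant C a.+1 b +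
    count (fun c => c.1 * M + c.2 == a * M + b) C.
Proof.
move=> lt_b lt_C; rewrite quadrant_rectangle //; congr (_ + _).
apply: eq_in_count => -[x y] /lt_C /= lt_y.
apply/idP/eqP => [|eq_xy]; first by move=> ?; congr (_ * _ + _); lia.
have -> : x = a.
  by have := congr1 (divn^~ M) eq_xy; rewrite !divnMDl ?divn_small ?addn0 //; lia.
have -> : y = b.
  by have := congr1 (modn^~ M) eq_xy; rewrite !modnMDl !modn_small.
by rewrite !ltnSn !leqnn.
Qed.

(** A block may stick out of the grid; clipping it at [M] loses nothing, since all occupied cells
    are inside. *)
Lemma quadrant_block C M i j len : i <= M -> j <= M ->
  (forall c, c \in C -> c.1 < M /\ c.2 < M) ->
  quadrant C (minn (i + len) M) (minn (j + len) M) + quadrant C i j =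
  quadrant C i (minn (j + len) M) + quadrant C (minn (i + len) M) j + block C i j len.
Proof.
move=> le_i le_j lt_C; rewrite quadrant_rectangle; try lia.
congr (_ + _); apply: eq_in_count => -[x y] /lt_C /= [lt_x lt_y]; lia.
Qed.

Lemma leq_quadrant C a b a' b' : a <= a' -> b <= b' ->
  quadrant C a b <= quadrant C a' b'.
Proof. by move=> le_a le_b; apply: sub_count => -[x y] /=; lia. Qed.

Lemma leq_block C i j len len' : len <= len' -> block C i j len <= block C i j len'.
Proof. by move=> le_len; apply: sub_count => -[x y] /=; lia. Qed.

Lemma block0 C i j : block C i j 0 = 0.
Proof.
by rewrite /block (eq_count (a2 := pred0)) ?count_pred0 // => -[x y] /=; lia.
Qed.

End Quadrants.

(** * From blocks of cells to squares and back *)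

Section Cells.
Variable R : realType.
Local Open Scope ring_scope.
Implicit Types (pts : seq (R * R)) (B Q : square R) (p : R * R) (delta : R).

Definition cell B delta p : nat * nat :=
  (Num.truncn ((p.1 - (corner B).1) / delta),
   Num.truncn ((p.2 - (corner B).2) / delta)).

Definition cells B delta pts : seq (nat * nat) :=
  [seq cell B delta p | p <- pts & encloses B p].

Definition block_square B delta i j len : square R :=
  Square ((corner B).1 + i%:R * delta, (corner B).2 + j%:R * delta)
         (len%:R * delta).

Definition box (v : R * R) (r : R) : square R :=
  Square (v.1 - 2%:R * r, v.2 - 2%:R * r) (4%:R * r).

Lemma count_block B delta pts i j len :
  block (cells B delta pts) i j len =
  count (fun p => [&& encloses B p, (i <= (cell B delta p).1 < i + len)%N &
    (j <= (cell B delta p).2 < j + len)%N]) pts.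
Proof.
rewrite /block /cells count_map count_filter; apply: eq_count => p /=.
by rewrite andbC.
Qed.

Lemma coordinate_cell (x b delta : R) (i len : nat) : 0 < delta -> b <= x ->
  (i <= Num.truncn ((x - b) / delta) < i + len)%N ->
  b + i%:R * delta <= x <= b + i%:R * delta + len%:R * delta.
Proof.
move=> d_gt0 le_bx; have q_ge0 : 0 <= (x - b) / delta.
  by rewrite divr_ge0 ?subr_ge0 // ltW.
rewrite truncn_ge_nat // truncn_lt_nat // ler_pdivlMr // ltr_pdivrMr //.
rewrite natrD mulrDl => /andP[le_i /ltW lt_i].
by rewrite -lerBrDl le_i -addrA -lerBlDl lt_i.
Qed.

Lemma block_k_enclosing B delta pts i j len k : 0 < delta ->
  (k <= block (cells B delta pts) i j len)%N ->
  k_enclosing pts k (block_square B delta i j len).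
Proof.
move=> d_gt0 le_k; split; first by rewrite mulr_ge0 ?ler0n // ltW.
apply: leq_trans le_k _; rewrite count_block; apply: sub_count => p.
case/and3P => /andP[/andP[Bx _] /andP[By _]] cx cy.
by rewrite /encloses /= !coordinate_cell.
Qed.

(** The side [4 * r] of the box is [8 * N] cells, and points on the closed upper edge have index
    [8 * N]; hence [8 * N + 1] indices. *)
Lemma cell_lt v (r : R) (N : nat) p : 0 < r -> (0 < N)%N ->
  encloses (box v r) p ->
  let c := cell (box v r) (r / (2 * N)%N%:R) p in
  (c.1 < 8 * N + 1)%N /\ (c.2 < 8 * N + 1)%N.
Proof.
move=> r_gt0 N_gt0.
have d_gt0 : 0 < r / (2 * N)%N%:R by rewrite divr_gt0 // ltr0n muln_gt0.
have cell1 (x b : R) : b <= x <= b + 4%:R * r ->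
    (Num.truncn ((x - b) / (r / (2 * N)%N%:R)) < 8 * N + 1)%N.
  move=> /andP[le_bx le_xb]; rewrite addn1 ltnS -[X in (_ <= X)%N](@natrK R).
  apply: le_truncn; rewrite ler_pdivrMr // mulrC.
  have -> : r / (2 * N)%N%:R * (8 * N)%N%:R = 4%:R * r.
    have N_neq0 : N%:R != 0 :> R by rewrite pnatr_eq0 -lt0n.
    by rewrite !natrM; field.
  by rewrite lerBlDl.
by move=> /andP[ex ey]; split; apply: cell1.
Qed.

(* A square touched by [v] of side at most [2 r] lies in the box around [v]. *)
Lemma enclosed_block v (r delta : R) pts k Q : 0 < r -> 0 < delta ->
  encloses Q v -> k_enclosing pts k Q -> side Q <= 2 * r ->
  exists i j, (k <= block (cells (box v r) delta pts) i j
                     (Num.truncn (side Q / delta)).+2)%N.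
Proof.
move=> r_gt0 d_gt0 Qv [Q_ge0 kQ] le_Q.
(* An interval of length [side Q] can start anywhere inside a cell: one extra cell for rounding the
   length, one for the offset of the start. *)
set len := _.+2; have len_gt : side Q / delta + 1 < len%:R.
  by rewrite /len -[_.+2]addn1 natrD ltrD2r truncnS_gt.
have cell1 (a x b : R) : b <= a -> a <= x <= a + side Q ->
    (Num.truncn ((a - b) / delta) <= Num.truncn ((x - b) / delta)
       < Num.truncn ((a - b) / delta) + len)%N.
  move=> le_ba /andP[le_ax le_xa].
  have a_ge0 : 0 <= (a - b) / delta by rewrite divr_ge0 ?subr_ge0 // ltW.
  have x_ge0 : 0 <= (x - b) / delta.
    by rewrite divr_ge0 ?subr_ge0 ?(le_trans le_ba) // ltW.
  apply/andP; split.
    by apply: le_truncn; rewrite ler_pM2r ?invr_gt0 // lerB.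
  rewrite truncn_lt_nat // natrD.
  have := truncnS_gt ((a - b) / delta); rewrite -addn1 natrD => lt_a.
  have : (x - b) / delta <= (a - b) / delta + side Q / delta.
    by rewrite -mulrDl ler_pM2r ?invr_gt0 //; lra.
  lra.
exists (cell (box v r) delta (corner Q)).1, (cell (box v r) delta (corner Q)).2.
apply: leq_trans kQ _; rewrite count_block; apply: sub_count => p.
move: Qv; rewrite /encloses => /andP[/andP[v1 v2] /andP[v3 v4]].
move=> /andP[p12 p34]; have /andP[p1 p2] := p12; have /andP[p3 p4] := p34.
apply/and3P; split.
- by do !(apply/andP; split) => /=; lra.
- by apply: cell1 p12 => /=; lra.
- by apply: cell1 p34 => /=; lra.
Qed.

End Cells.

(** * The grid search *)

Definition grid_setup :=
  Seq (If (BRealLe (rscalar 2) (ROfInt (num 1)))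
         (assign 25 (IAdd (IFloor (RDiv (ROfInt (num 1)) (rscalar 2))) (num 1)))
         (assign 25 (num 1)))
 (Seq (assign 26 (IAdd (IMul (num 8) (scalar 25)) (num 1)))
 (Seq (assign 27 (scalar 26))
 (Seq (assign 31 (IMul (scalar 26) (scalar 26)))
 (Seq (assign 32 (IAdd (scalar 26) (num 1)))
 (Seq (assign 33 (IMul (scalar 32) (scalar 32)))
      (RSet 15 (num 0)
         (RDiv (rscalar 12) (ROfInt (IMul (num 2) (scalar 25)))))))))).

Definition in_box :=
  BAnd (BAnd (BRealLe (rscalar 16) (RGet 0 (scalar 18)))
             (BRealLe (RGet 0 (scalar 18))
                      (RAdd (rscalar 16) (RMul (ROfInt (num 4)) (rscalar 12)))))
       (BAnd (BRealLe (rscalar 17) (RGet 1 (scalar 18)))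
             (BRealLe (RGet 1 (scalar 18))
                      (RAdd (rscalar 17) (RMul (ROfInt (num 4)) (rscalar 12))))).

Definition cell_index :=
  IAdd (IMul (IFloor (RDiv (RSub (RGet 0 (scalar 18)) (rscalar 16)) (rscalar 15)))
             (scalar 26))
       (IFloor (RDiv (RSub (RGet 1 (scalar 18)) (rscalar 17)) (rscalar 15))).

(** The counters are cleared at each vertex, as they hold arbitrary values at first and those of the
    preceding vertex later. *)
Definition grid_counts :=
  Seq (For 30 31 (ISet 28 (scalar 30) (num 0)))
      (For 18 0 (If in_box
         (ISet 28 cell_index (IAdd (IGet 28 cell_index) (num 1))) Skip)).

(** The table has width [M.+1], with a zero row and a zero column, and is filled in the order of
    addresses. Adding before subtracting keeps intermediate values natural. *)
Definition grid_quadrants :=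
  For 30 33
   (Seq (Seq (assign 34 (idiv (scalar 30) (scalar 32)))
             (assign 35 (ISub (scalar 30) (IMul (scalar 34) (scalar 32)))))
     (If (BAnd (BIntLe (num 1) (scalar 34)) (BIntLe (num 1) (scalar 35)))
       (ISet 29 (scalar 30)
         (ISub (IAdd (IAdd (IGet 28 (IAdd (IMul (ISub (scalar 34) (num 1)) (scalar 26))
                                          (ISub (scalar 35) (num 1))))
                           (IGet 29 (ISub (scalar 30) (num 1))))
                     (IGet 29 (ISub (scalar 30) (scalar 32))))
               (IGet 29 (ISub (ISub (scalar 30) (scalar 32)) (num 1)))))
       (ISet 29 (scalar 30) (num 0)))).

Definition quadrant_at e f := IGet 29 (IAdd (IMul e (scalar 32)) f).

Definition block_count :=
  Seq (Seq (assign 34 (idiv (scalar 30) (scalar 26)))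
           (assign 35 (ISub (scalar 30) (IMul (scalar 34) (scalar 26)))))
 (Seq (Seq (assign 36 (ISub (IAdd (scalar 34) (scalar 27)) (num 1)))
           (If (BIntLe (scalar 36) (scalar 26)) Skip (assign 36 (scalar 26))))
 (Seq (Seq (assign 37 (ISub (IAdd (scalar 35) (scalar 27)) (num 1)))
           (If (BIntLe (scalar 37) (scalar 26)) Skip (assign 37 (scalar 26))))
      (assign 38 (ISub (ISub (IAdd (quadrant_at (scalar 36) (scalar 37))
                                   (quadrant_at (scalar 34) (scalar 35)))
                             (quadrant_at (scalar 34) (scalar 37)))
                       (quadrant_at (scalar 36) (scalar 35)))))).

Definition record_block :=
  Seq (assign 27 (ISub (scalar 27) (num 1)))
 (Seq (RSet 3 (num 0)
         (RAdd (rscalar 16) (RMul (ROfInt (scalar 34)) (rscalar 15))))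
 (Seq (RSet 3 (num 1)
         (RAdd (rscalar 17) (RMul (ROfInt (scalar 35)) (rscalar 15))))
      (RSet 3 (num 2) (RMul (ROfInt (scalar 27)) (rscalar 15))))).

(** The block tested is one smaller than the best so far. After a success the position is kept and
    tested again; the best size in cell 27 is carried over from one vertex to the next. *)
Definition grid_scan :=
  Seq (assign 30 (num 0))
      (While (BNot (BIntLe (scalar 31) (scalar 30)))
         (Seq block_count
              (If (BIntLe (scalar 1) (scalar 38)) record_block (incr 30)))).

Definition grid_vertex :=
  Seq vertex
 (Seq (Seq (RSet 16 (num 0)
              (RSub (rscalar 13) (RMul (ROfInt (num 2)) (rscalar 12))))
           (RSet 17 (num 0)
              (RSub (rscalar 14) (RMul (ROfInt (num 2)) (rscalar 12)))))
 (Seq grid_counts (Seq grid_quadrants grid_scan))).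

Definition smallest_block := Seq grid_setup (For 22 24 grid_vertex).

Section Grid.
Variables (R : realType) (W : nat).
Implicit Types (s : store R) (pts : seq (R * R)) (B : square R) (C : seq (nat * nat)).

Definition resolution (eps : R) : nat :=
  if (eps <= 1)%R then (Num.truncn (1 / eps)%R).+1 else 1.

Lemma runs_grid_setup s eps r0 :
  let N := resolution eps in let M := 8 * N + 1 in
  reals s 2 0 = eps -> (0 < eps)%R -> reals s 12 0 = r0 -> M.+1 * M.+1 <= W ->
  runs W grid_setup s 9 (fun s' =>
    [/\ ints s' 26 0 = Posz M, ints s' 27 0 = Posz M, ints s' 31 0 = Posz (M * M),
        ints s' 32 0 = Posz M.+1 & ints s' 33 0 = Posz (M.+1 * M.+1)] /\
    reals s' 15 0 = (r0 / (2 * N)%N%:R)%R).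
Proof.
move=> N M s2 eps_gt0 s12 le_W.
have N_gt0 : 0 < N by rewrite /N /resolution; case: ifP.
apply: (@runs_time _ _ _ _ (3 + 6)) => //.
apply: (runs_seq (Q1 := fun s' => ints s' 25 0 = Posz N)).
  apply: (@runs_straight _ _ (If _ _ _)); reads; rewrite s2 /= mulr1n /N /resolution.
  split=> //; have le_N : N <= W by nia.
  move: le_N; rewrite /N /resolution; case: ifP => // _ le_N.
  have q_ge0 : (0 <= 1 / eps)%R by rewrite divr_ge0 // ltW.
  rewrite addn1; do !split => //; first by rewrite gt_eqF.
  exact: ltnW.
move=> s1 F1 s1_25; apply: runs_straight; reads.
have -> : reals s1 12 0 = r0 by framed.
rewrite s1_25 /= -/M !addn1 -addn1 -/M.
by do !split => //; rewrite ?pnatr_eq0 ?addn1; nia.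
Qed.

Lemma runs_grid_counts s pts B r delta M :
  let C := cells B delta pts in
  ints s 0 0 = Posz (size pts) -> size pts <= W ->
  ints s 26 0 = Posz M -> ints s 31 0 = Posz (M * M) -> M * M <= W ->
  holds (reals s 0) [seq p.1 | p <- pts] ->
  holds (reals s 1) [seq p.2 | p <- pts] ->
  reals s 16 0 = (corner B).1 -> reals s 17 0 = (corner B).2 ->
  reals s 12 0 = r -> side B = (4%:R * r)%R -> reals s 15 0 = delta ->
  (0 < delta)%R ->
  (forall p, encloses B p ->
     (cell B delta p).1 < M /\ (cell B delta p).2 < M) ->
  runs W grid_counts s (M * M * 3 + size pts * 5 + 4) (fun s' =>
    forall c, c < M * M ->
    ints s' 28 c = Posz (count (fun c' => c'.1 * M + c'.2 == c) C)).
Proof.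
move=> C s0 nW s26 s31 MW hx hy s16 s17 s12 sideB s15 d_gt0 lt_cell.
apply: (@runs_time _ _ _ _ ((M * M * (1 + 2) + 2) + (size pts * (3 + 2) + 2))); last by lia.
apply: runs_seq.
  pose I j s' := forall c, c < j -> ints s' 28 c = Posz 0.
  apply: (@runs_for _ _ 30 31 (ISet 28 (scalar 30) (num 0)) s (M * M) 1 I) => //.
  move=> j s' lt_j F s'30 Ij; apply: runs_straight; reads; rewrite s'30 /=.
  do ?split => // c; rewrite ltnS leq_eqVlt => /orP[/eqP ->|lt_cj]; reads => //.
  by rewrite upd_neqi ?Ij // neq_ltn lt_cj.
move=> s1 F1 zero.
pose cnt j c := count (fun c' => c'.1 * M + c'.2 == c) (cells B delta (take j pts)).
pose I j s' := forall c, c < M * M -> ints s' 28 c = Posz (cnt j c).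
apply: runs_weaken (runs_for (I := I) (B := 3) _ _ _ nW _ _) (leqnn _) _ => //.
- by framed.
- move=> c lt_c /=; reads; rewrite zero //.
  by rewrite /cnt take0.
- move=> j s2 lt_j F2 s2_18 Ij.
  set p := nth 0%R pts j.
  have cntS c : cnt j.+1 c = cnt j c + (encloses B p &&
      ((cell B delta p).1 * M + (cell B delta p).2 == c)).
    rewrite /cnt /cells (take_nth 0%R) // filter_rcons -/p.
    case: (encloses B p); last by rewrite addn0.
    by rewrite map_rcons -cats1 count_cat /= addn0.
  have x_j : reals s2 0 j = p.1 by framed; rewrite hx ?size_map // (nth_map 0%R).
  have y_j : reals s2 1 j = p.2 by framed; rewrite hy ?size_map // (nth_map 0%R).
  have s2_16 : reals s2 16 0 = (corner B).1 by framed.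
  have s2_17 : reals s2 17 0 = (corner B).2 by framed.
  have s2_12 : reals s2 12 0 = r by framed.
  have s2_15 : reals s2 15 0 = delta by framed.
  have s2_26 : ints s2 26 0 = Posz M by framed.
  apply: (@runs_straight _ _ (If _ _ _)) => /=.
  rewrite s2_18 /= x_j y_j s2_16 s2_17 s2_12 s2_15 s2_26 /=.
  rewrite -sideB -/(encloses B p).
  split; first by do !split.
  case E: (encloses B p) cntS => cntS; last first.
    by move=> c lt_c /=; reads; rewrite Ij // cntS addn0.
  have [lt1 lt2] := lt_cell p E.
  move: lt1 lt2 cntS; rewrite /cell /=; set a := Num.truncn _; set b := Num.truncn _.
  move=> lt_a lt_b cntS.
  have lt_ab : a * M + b < M * M by nia.
  have cnt_le : cnt j (a * M + b) <= j.
    rewrite (leq_trans (count_size _ _)) // size_map size_filter.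
    by rewrite (leq_trans (count_size _ _)) // size_takel // ltnW.
  have /andP[/andP[bx _] /andP[b_y _]] := E.
  rewrite Ij //=.
  split=> //.
  + by do !split => //; rewrite ?(gt_eqF d_gt0) ?divr_ge0 ?subr_ge0 ?(ltW d_gt0) //; nia.
  + by do !split => //; rewrite ?(gt_eqF d_gt0) ?divr_ge0 ?subr_ge0 ?(ltW d_gt0) //; nia.
  move=> c lt_c; reads; rewrite cntS /=.
  have [<-|neq_c] := eqVneq (a * M + b) c; first by rewrite upd_eq.
  by rewrite upd_neqi 1?eq_sym // Ij // addn0.
move=> s' F Is' c lt_c; rewrite Is' // /cnt take_size //.
Qed.

Lemma runs_grid_quadrants s C M n :
  ints s 26 0 = Posz M -> ints s 32 0 = Posz M.+1 ->
  ints s 33 0 = Posz (M.+1 * M.+1) -> M.+1 * M.+1 <= W -> 3 * n <= W ->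
  size C <= n -> (forall c, c \in C -> c.1 < M /\ c.2 < M) ->
  (forall c, c < M * M ->
    ints s 28 c = Posz (count (fun c' => c'.1 * M + c'.2 == c) C)) ->
  runs W grid_quadrants s (M.+1 * M.+1 * 7 + 2) (fun s' =>
    forall a b, a <= M -> b <= M ->
    ints s' 29 (a * M.+1 + b) = Posz (quadrant C a b)).
Proof.
move=> s26 s32 s33 MW nW le_C lt_C h28.
pose I j s' := forall a b, b <= M -> a * M.+1 + b < j ->
  ints s' 29 (a * M.+1 + b) = Posz (quadrant C a b).
apply: (@runs_time _ _ _ _ (M.+1 * M.+1 * (5 + 2) + 2)); last by lia.
apply: runs_weaken (runs_for (I := I) (B := 5) _ _ s33 MW _ _) (leqnn _) _ => //.
- move=> j s1 lt_j F1 s1_30 Ij.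
  have s1_32 : ints s1 32 0 = Posz M.+1 by framed.
  have s1_26 : ints s1 26 0 = Posz M by framed.
  set a := j %/ M.+1; set b := j %% M.+1.
  have j_eq : j = a * M.+1 + b by apply: divn_eq.
  have lt_b : b < M.+1 by rewrite ltn_mod.
  have lt_a : a < M.+1 by rewrite ltn_divLR.
  apply: (runs_seq (T1 := 2) (T2 := 3) (Q1 := fun s' => ints s' 34 0 = Posz a /\
     ints s' 35 0 = Posz b)).
    apply: runs_straight; reads; rewrite s1_30 s1_32 /= truncn_div // -/a.
    have -> : j - a * M.+1 = b by lia.
    by do !split => //; rewrite ?pnatr_eq0 ?divr_ge0 ?ler0n //; nia.
  move=> s2 F2 [s2_34 s2_35].
  have s2_30 : ints s2 30 0 = Posz j by framed.
  have s2_32 : ints s2 32 0 = Posz M.+1 by framed.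
  have s2_26 : ints s2 26 0 = Posz M by framed.
  apply: (@runs_straight _ _ (If _ _ _)); reads.
  have qs x y : y <= M -> x * M.+1 + y < j ->
    ints s2 29 (x * M.+1 + y) = Posz (quadrant C x y) by framed; apply: Ij.
  have fin (z : int) : z = Posz (quadrant C a b) ->
     I j.+1 (iset (Store (upd (ints s2) 29 j z) (reals s2)) 30 0 j.+1).
    move=> -> x y le_y; rewrite ltnS leq_eqVlt => /orP[/eqP eq_j|lt_xy]; reads.
      have x_a : x = a by rewrite /a -eq_j divnMDl // divn_small // addn0.
      have y_b : y = b by rewrite /b -eq_j modnMDl modn_small.
      by rewrite eq_j upd_eq x_a y_b.
    by rewrite upd_neqi ?qs // neq_ltn lt_xy.
  rewrite s2_34 s2_35 s2_30 s2_32 s2_26 /=; split; first by [].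
  case: ifP => [/andP[a_gt0 b_gt0]|ab0]; last first.
    split=> //; apply: fin; congr Posz.
    have [->|a_gt0] := posnP a; first by rewrite quadrant0l.
    have [->|b_gt0] := posnP b; first by rewrite quadrant0r.
    by rewrite a_gt0 b_gt0 in ab0.
  have lt_ab : (a - 1) * M + (b - 1) < M * M by nia.
  (* The three addresses read are those of [(a, b - 1)], [(a - 1, b)] and [(a - 1, b - 1)], all
     below [j] and hence covered by the invariant. *)
  have -> : j - 1 = a * M.+1 + (b - 1) by rewrite addnBA // -j_eq.
  have -> : j - M.+1 = (a - 1) * M.+1 + b.
    by rewrite j_eq mulnBl mul1n addnBAC // leq_pmull.
  have -> : (a - 1) * M.+1 + b - 1 = (a - 1) * M.+1 + (b - 1).
    by rewrite addnBA.
  have -> : ints s2 28 ((a - 1) * M + (b - 1)) = Posz (count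
      (fun c' => c'.1 * M + c'.2 == (a - 1) * M + (b - 1)) C) by framed; apply: h28.
  rewrite !qs /=; try nia.
  have qle x y : quadrant C x y <= n by apply: leq_trans (count_size _ _) le_C.
  have cle : count (fun c' => c'.1 * M + c'.2 == (a - 1) * M + (b - 1)) C <= n.
    exact: leq_trans (count_size _ _) le_C.
  have lt_C2 c : c \in C -> c.2 < M by case/lt_C.
  have lt_b1 : b - 1 < M by lia.
  have := quadrant_cell (a - 1) lt_b1 lt_C2.
  have -> : (a - 1).+1 = a by lia.
  have -> : (b - 1).+1 = b by lia.
  move: (qle (a - 1) (b - 1)) (qle a b) (qle (a - 1) b) (qle a (b - 1)) cle.
  set q1 := quadrant _ _ _; set q2 := quadrant _ _ _; set q3 := quadrant _ _ _.
  set q4 := quadrant _ _ _; set q5 := count _ _ => l1 l2 l3 l4 l5 q_eq.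
  have h1 : (a - 1) * M + (b - 1) <= W by nia.
  have h2 : (a - 1) * M <= W by apply: leq_trans h1; apply: leq_addr.
  have h6 : (a - 1) * M.+1 + (b - 1) <= W by nia.
  have h7 : 0 < (a - 1) * M.+1 + b by rewrite addn_gt0 b_gt0 orbT.
  have h3 : M.+1 <= j by rewrite j_eq; nia.
  have h4 : (a - 1) * M.+1 + b <= W by nia.
  have h5 : a * M.+1 + (b - 1) <= W by nia.
  split; first by [].
  + by do !split => //; lia.
  by apply: fin; congr Posz; rewrite -/q2; lia.
move=> s' F Is' a b le_a le_b; apply: Is' => //; nia.
Qed.

End Grid.

(** * The scan with a shrinking block size *)

Section Scan.
Variables (R : realType) (W : nat).
Implicit Types (s : store R) (pts : seq (R * R)) (B : square R) (C : seq (nat * nat)).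

Lemma runs_block_count s C M n len j :
  ints s 26 0 = Posz M -> ints s 32 0 = Posz M.+1 -> ints s 27 0 = Posz len ->
  ints s 30 0 = Posz j -> j < M * M -> 0 < len <= M ->
  M.+1 * M.+1 <= W -> 3 * n <= W -> size C <= n ->
  (forall c, c \in C -> c.1 < M /\ c.2 < M) ->
  (forall a b, a <= M -> b <= M ->
    ints s 29 (a * M.+1 + b) = Posz (quadrant C a b)) ->
  runs W block_count s 11 (fun s' => [/\ ints s' 34 0 = Posz (j %/ M),
    ints s' 35 0 = Posz (j %% M) &
    ints s' 38 0 = Posz (block C (j %/ M) (j %% M) (len - 1))]).
Proof.
move=> s26 s32 s27 s30 lt_j /andP[len_gt0 le_len] MW nW le_C lt_C h29.
have M_gt0 : 0 < M by case: M lt_j {h29 lt_C s26 s32 le_len MW}.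
set a := j %/ M; set b := j %% M.
have j_eq : j = a * M + b by apply: divn_eq.
have lt_b : b < M by rewrite ltn_mod.
have lt_a : a < M by rewrite ltn_divLR.
have MW1 : 2 * M < W by nia.
apply: (@runs_time _ _ _ _ (2 + (4 + (4 + 1)))) => //.
apply: (runs_seq (Q1 := fun s' => ints s' 34 0 = Posz a /\ ints s' 35 0 = Posz b)).
  apply: runs_straight; reads; rewrite s30 s26 /= truncn_div // -/a.
  have -> : j - a * M = b by lia.
  by do !split => //; rewrite ?pnatr_eq0 -?lt0n ?divr_ge0 ?ler0n //; nia.
move=> s1 F1 [s1_34 s1_35].
set a2 := minn (a + (len - 1)) M; set b2 := minn (b + (len - 1)) M.
apply: (runs_seq (Q1 := fun s' => ints s' 36 0 = Posz a2)).
  apply: runs_straight; reads.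
  have -> : ints s1 26 0 = Posz M by framed.
  have -> : ints s1 27 0 = Posz len by framed.
  rewrite s1_34 /= /a2; split=> //; first by do !split => //; lia.
  split=> //; case: ifP => le_M; reads; do ?split => //; congr Posz; lia.
move=> s2 F2 s2_36.
apply: (runs_seq (Q1 := fun s' => ints s' 37 0 = Posz b2)).
  apply: runs_straight; reads.
  have -> : ints s2 26 0 = Posz M by framed.
  have -> : ints s2 27 0 = Posz len by framed.
  have -> : ints s2 35 0 = Posz b by framed.
  rewrite /= /b2; split=> //; first by do !split => //; lia.
  split=> //; case: ifP => le_M; reads; do ?split => //; congr Posz; lia.
move=> s3 F3 s3_37; apply: runs_straight; reads.
have s3_34 : ints s3 34 0 = Posz a by framed.
have s3_35 : ints s3 35 0 = Posz b by framed.
have -> : ints s3 36 0 = Posz a2 by framed.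
have -> : ints s3 32 0 = Posz M.+1 by framed.
have h3 x y : x <= M -> y <= M ->
    ints s3 29 (x * M.+1 + y) = Posz (quadrant C x y).
  by framed; apply: h29.
have a2M : a2 <= M by rewrite geq_minr.
have b2M : b2 <= M by rewrite geq_minr.
have le_a2 : a <= a2 by rewrite /a2; lia.
have le_b2 : b <= b2 by rewrite /b2; lia.
rewrite s3_34 s3_35 s3_37 /= !h3 ?(ltnW lt_a) ?(ltnW lt_b) //=.
have qle x y : quadrant C x y <= n by apply: leq_trans (count_size _ _) le_C.
have := quadrant_block (len - 1) (ltnW lt_a) (ltnW lt_b) lt_C.
rewrite -/a2 -/b2.
have q21 := leq_quadrant C (leqnn a2) le_b2.
have q22 := leq_quadrant C le_a2 (leqnn b2).
move: (qle a2 b2) (qle a b) (qle a b2) (qle a2 b) q21 q22.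
set q1 := quadrant _ _ _; set q2 := quadrant _ _ _; set q3 := quadrant _ _ _.
set q4 := quadrant _ _ _; set q5 := block _ _ _ _ => l1 l2 l3 l4 l5 l6 q_eq.
have bound x y : x <= M -> y <= M -> x * M.+1 + y <= W.
  by move=> xM yM; have : x * M.+1 <= M * M.+1 by [rewrite leq_mul2r xM orbT]; lia.
have bound0 x : x <= M -> x * M.+1 <= W.
  by move=> xM; have := bound x 0 xM (leq0n M); rewrite addn0.
by do !split => //; rewrite ?bound ?bound0 ?(ltnW lt_a) ?(ltnW lt_b) //;
  try congr Posz; lia.
Qed.

(** Each round shrinks the best size or advances the position, so [M * M - j + m'] drops by one. A
    position where size [m' - 1] fails can be left for good, because block counts are monotone in
    the size and the best size never grows. *)
Lemma runs_grid_scan s B delta C M n k m :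
  ints s 1 0 = Posz k -> 0 < k ->
  ints s 26 0 = Posz M -> ints s 32 0 = Posz M.+1 -> ints s 27 0 = Posz m ->
  ints s 31 0 = Posz (M * M) -> 0 < m <= M ->
  M.+1 * M.+1 <= W -> 3 * n <= W -> size C <= n ->
  (forall c, c \in C -> c.1 < M /\ c.2 < M) ->
  (forall a b, a <= M -> b <= M ->
    ints s 29 (a * M.+1 + b) = Posz (quadrant C a b)) ->
  reals s 16 0 = (corner B).1 -> reals s 17 0 = (corner B).2 ->
  reals s 15 0 = delta ->
  runs W grid_scan s ((M * M + M) * 18 + 2) (fun s' => exists m',
    [/\ ints s' 27 0 = Posz m', 0 < m' <= m,
        (m' = m /\ output_square s' = output_square s) \/
        (exists i j, k <= block C i j m' /\
           output_square s' = block_square B delta i j m') &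
        forall i j len, k <= block C i j len -> m' <= len]).
Proof.
move=> s1 k_gt0 s26 s32 s27 s31 /andP[m_gt0 le_m] MW nW le_C lt_C h29 s16 s17 s15.
have M_gt0 : 0 < M by lia.
have MMW : M * M < W by nia.
apply: (@runs_time _ _ _ _ (1 + ((M * M + M) * 18 + 1))); last by lia.
apply: (runs_seq (Q1 := eq (iset s 30 0 0))); first exact: runs_straight.
move=> s2 F2 eq_s2; subst s2.
pose J c s' := exists m' j, [/\ c = M * M - j + m', ints s' 27 0 = Posz m' /\
  ints s' 30 0 = Posz j, 0 < m' <= m /\ j <= M * M,
  (m' = m /\ output_square s' = output_square s) \/
  (exists i i', k <= block C i i' m' /\
           output_square s' = block_square B delta i i' m') &
  forall x y len, x * M + y < j -> y < M -> k <= block C x y len -> m' <= len].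
apply: (@runs_time _ _ _ _ ((M * M + m) * 18 + 1)); last by lia.
apply: (@runs_while _ _ _ _ _ _ J); last first.
  exists m, 0; split=> //; first by rewrite subn0.
  - by rewrite m_gt0 leqnn.
  - by left.
move=> c s3 F3 [m' [j [-> [s3_27 s3_30] [/andP[m'_gt0 le_m'] le_j] out lower]]].
have s3_31 : ints s3 31 0 = Posz (M * M) by framed.
split; first by rewrite /= s3_31 s3_30.
rewrite /= s3_31 s3_30 /= -ltnNge; case: ltnP => [lt_j|ge_j]; last first.
  exists m'; split=> //; first by rewrite m'_gt0.
  (* A block with at least one point starts no further than the cell of that point, hence at a
     position that the scan has visited. *)
  move=> x y len le_k; have : has (fun c => (x <= c.1 < x + len) && (y <= c.2 < y + len)) C.
    by rewrite has_count (leq_trans k_gt0).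
  case/hasP => d /lt_C [lt_d1 lt_d2] /andP[/andP[xd _] /andP[yd _]].
  have lt_x := leq_ltn_trans xd lt_d1; have lt_y := leq_ltn_trans yd lt_d2.
  apply: (lower x y) => //.
  have : x * M <= M.-1 * M by rewrite leq_mul2r; apply/orP; right; lia.
  by have : M.-1 * M + M = M * M by [rewrite -mulSnr prednK]; lia.
apply: (runs_seq (T1 := 11) (T2 := 6)).
  apply: (runs_block_count (C := C) (M := M) (n := n) (len := m') (j := j)) => //.
  - by framed.
  - by framed.
  - by rewrite m'_gt0; lia.
  - by move=> a b aM bM; framed; apply: h29.
move=> s4 F4 [s4_34 s4_35 s4_38].
set a := j %/ M in s4_34 s4_38; set b := j %% M in s4_35 s4_38.
have j_eq : j = a * M + b by apply: divn_eq.
have lt_b : b < M by rewrite ltn_mod.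
have out_eq : output_square s4 = output_square s3 by rewrite /output_square; framed.
apply: (@runs_straight _ _ (If _ _ _)); reads.
have -> : ints s4 1 0 = Posz k by framed.
have s4_27 : ints s4 27 0 = Posz m' by framed.
have s4_30 : ints s4 30 0 = Posz j by framed.
have s4_16 : reals s4 16 0 = (corner B).1 by framed.
have s4_17 : reals s4 17 0 = (corner B).2 by framed.
have s4_15 : reals s4 15 0 = delta by framed.
rewrite s4_38 s4_27 s4_34 s4_35 s4_30 s4_16 s4_17 s4_15 /=.
split=> //; case: ifP => [le_k|/negbT not_k].
  (* A block of size 0 holds no point, so the best size stays positive. *)
  have m'1 : 0 < m' - 1.
    by rewrite lt0n; apply: contraTneq le_k => ->; rewrite block0 -ltnNge.
  split=> //; first by do !split => //; lia.
  do ?split => //.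
  exists (M * M - j + (m' - 1)); first by lia.
  exists (m' - 1), j; split=> //.
  - by split=> //; lia.
  - by right; exists a, b.
  - move=> x y len lt_xy lt_y le_k'; have := lower x y len lt_xy lt_y le_k'; lia.
split=> //; first by do !split => //; lia.
rewrite addn1; exists (M * M - j.+1 + m'); first by lia.
exists m', j.+1; split=> //.
- by split=> //; rewrite m'_gt0.
- by move: out; rewrite -out_eq.
move=> x y len; rewrite ltnS leq_eqVlt => /orP[/eqP eq_j|lt_xy] lt_y le_k'.
  have x_a : x = a by rewrite /a -eq_j divnMDl // divn_small // addn0.
  have y_b : y = b by rewrite /b -eq_j modnMDl modn_small.
  rewrite leqNgt; apply: contra not_k => lt_len; rewrite -x_a -y_b.
  by apply: leq_trans le_k' _; apply: leq_block; lia.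
exact: lower lt_xy lt_y le_k'.
Qed.

End Scan.

Section SmallestBlock.
Variables (R : realType) (W : nat).
Implicit Types (s : store R) (pts : seq (R * R)).

Definition vertex_cells X Y pts (r delta : R) t :=
  cells (box (vert X Y t) r) delta pts.

Lemma vertex_cells_lt X Y pts (r : R) N t : (0 < r)%R -> 0 < N ->
  forall c, c \in vertex_cells X Y pts r (r / (2 * N)%N%:R)%R t ->
  c.1 < 8 * N + 1 /\ c.2 < 8 * N + 1.
Proof.
move=> r_gt0 N_gt0 c /mapP[p]; rewrite mem_filter => /andP[Bp _] ->.
exact: cell_lt Bp.
Qed.

Lemma runs_grid_vertex s pts k X Y t (r0 : R) N m :
  let M := 8 * N + 1 in let delta := (r0 / (2 * N)%N%:R)%R in
  let C := vertex_cells X Y pts r0 delta t in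
  ints s 0 0 = Posz (size pts) -> ints s 1 0 = Posz k -> 0 < k ->
  holds (reals s 0) [seq p.1 | p <- pts] ->
  holds (reals s 1) [seq p.2 | p <- pts] ->
  ints s 21 0 = Posz (size Y) -> holds (reals s 7) X -> holds (reals s 8) Y ->
  ints s 22 0 = Posz t -> t < size X * size Y -> size X * size Y <= W ->
  reals s 12 0 = r0 -> (0 < r0)%R -> 0 < N ->
  ints s 26 0 = Posz M -> ints s 31 0 = Posz (M * M) ->
  ints s 32 0 = Posz M.+1 -> ints s 33 0 = Posz (M.+1 * M.+1) ->
  reals s 15 0 = delta -> ints s 27 0 = Posz m -> 0 < m <= M ->
  M.+1 * M.+1 <= W -> 3 * size pts <= W ->
  runs W grid_vertex s (M.+1 * M.+1 * 28 + size pts * 5 + 13) (fun s' =>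
    exists m', [/\ ints s' 27 0 = Posz m', 0 < m' <= m,
        (m' = m /\ output_square s' = output_square s) \/
        (exists i j, k <= block C i j m' /\
           output_square s' = block_square (box (vert X Y t) r0) delta i j m') &
        forall i j len, k <= block C i j len -> m' <= len]).
Proof.
move=> M delta C s0 s1 k_gt0 hx hy s21 hX hY s22 lt_t TW s12 r0_gt0 N_gt0 s26 s31
  s32 s33 s15 s27 le_m MW nW.
set B := box (vert X Y t) r0.
have delta_gt0 : (0 < delta)%R by rewrite divr_gt0 // ltr0n muln_gt0.
have lt_C c : c \in C -> c.1 < M /\ c.2 < M by apply: vertex_cells_lt.
have le_C : size C <= size pts.
  by rewrite size_map size_filter count_size.
apply: (@runs_time _ _ _ _ (3 + (2 + ((M * M * 3 + size pts * 5 + 4) +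
  ((M.+1 * M.+1 * 7 + 2) + ((M * M + M) * 18 + 2)))))); last by nia.
apply: runs_seq.
  by apply: (runs_vertex s22 s21 lt_t) => //; lia.
move=> s2 F2 [s2_13 s2_14].
apply: (runs_seq (Q1 := fun s' => reals s' 16 0 = (corner B).1 /\
    reals s' 17 0 = (corner B).2)).
  apply: runs_straight; reads.
  have -> : reals s2 12 0 = r0 by framed.
  by rewrite s2_13 s2_14; do !split.
move=> s3 F3 [s3_16 s3_17].
apply: runs_seq.
  apply: (runs_grid_counts (pts := pts) (B := B) (r := r0) (delta := delta) (M := M)).
  - by framed.
  - by lia.
  - by framed.
  - by framed.
  - by nia.
  - by framed.
  - by framed.
  - exact: s3_16.
  - exact: s3_17.
  - by framed.
  - by [].
  - by framed.
  - exact: delta_gt0.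
  - by move=> p; apply: cell_lt.
move=> s4 F4 h28.
apply: runs_seq.
  apply: (runs_grid_quadrants (C := C) (M := M) (n := size pts)) => //.
  - by framed.
  - by framed.
  - by framed.
move=> s5 F5 h29.
have out5 : output_square s5 = output_square s by rewrite /output_square; framed.
apply: runs_weaken (runs_grid_scan (B := B) (delta := delta) (C := C) (M := M)
  (n := size pts) (k := k) (m := m) _ _ _ _ _ _ _ _ _ _ _ _ _ _ _) (leqnn _) _ => //.
- by framed.
- by framed.
- by framed.
- by framed.
- by framed.
- by framed.
- by framed.
- by framed.
by move=> s6 F6 [m' [s6_27 le_m' out lower]]; exists m'; rewrite -out5.
Qed.

(** The alternative [m = M] is the initial size, with no square recorded yet; [block_approx]
    excludes it. *)
Lemma runs_smallest_block s pts k X Y (eps r0 : R) :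
  let N := resolution eps in let M := 8 * N + 1 in
  let delta := (r0 / (2 * N)%N%:R)%R in let T := size X * size Y in
  ints s 0 0 = Posz (size pts) -> ints s 1 0 = Posz k -> 0 < k ->
  holds (reals s 0) [seq p.1 | p <- pts] ->
  holds (reals s 1) [seq p.2 | p <- pts] ->
  reals s 2 0 = eps -> (0 < eps)%R ->
  ints s 21 0 = Posz (size Y) -> holds (reals s 7) X -> holds (reals s 8) Y ->
  ints s 24 0 = Posz T -> T <= W -> reals s 12 0 = r0 -> (0 < r0)%R ->
  M.+1 * M.+1 <= W -> 3 * size pts <= W ->
  runs W smallest_block s (T * (M.+1 * M.+1 * 28 + size pts * 5 + 15) + 11)
    (fun s' => exists2 m,
      (m = M \/ exists t i j, [/\ t < T,
         k <= block (vertex_cells X Y pts r0 delta t) i j m &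
         output_square s' = block_square (box (vert X Y t) r0) delta i j m]) &
      forall t i j len, t < T ->
        k <= block (vertex_cells X Y pts r0 delta t) i j len -> m <= len).
Proof.
move=> N M delta T s0 s1 k_gt0 hx hy s2 eps_gt0 s21 hX hY s24 TW s12 r0_gt0 MW nW.
have N_gt0 : 0 < N by rewrite /N /resolution; case: ifP.
apply: (@runs_time _ _ _ _ (9 + (T * (M.+1 * M.+1 * 28 + size pts * 5 + 13 + 2) + 2)));
  last by lia.
apply: runs_seq; first exact: (runs_grid_setup s2 eps_gt0 s12 MW).
move=> s3 F3 [[s3_26 s3_27 s3_31 s3_32 s3_33] s3_15].
rewrite -/N -/M in s3_26 s3_27 s3_31 s3_32 s3_33 s3_15.
pose I t s' := exists m, [/\ ints s' 27 0 = Posz m, 0 < m <= M,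
  m = M \/ (exists u i j, [/\ u < t,
         k <= block (vertex_cells X Y pts r0 delta u) i j m &
         output_square s' = block_square (box (vert X Y u) r0) delta i j m]) &
  forall u i j len, u < t ->
    k <= block (vertex_cells X Y pts r0 delta u) i j len -> m <= len].
have s3_24 : ints s3 24 0 = Posz T by framed.
apply: runs_weaken (runs_for (I := I)
  (B := M.+1 * M.+1 * 28 + size pts * 5 + 13) _ _ s3_24 TW _ _) (leqnn _) _ => //.
- by exists M; split; [reads | rewrite leqnn andbT /M addn1 | left | ].
- move=> t s4 lt_t F4 s4_22 [m [s4_27 le_m out lower]].
  apply: runs_weaken (runs_grid_vertex (pts := pts) (k := k) (X := X) (Y := Y)
    (t := t) (r0 := r0) (N := N) (m := m) _ _ _ _ _ _ _ _ _ _ _ _ _ _ _ _ _ _ _ _ _ _ _)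
    (leqnn _) _ => //.
  + by framed.
  + by framed.
  + by framed.
  + by framed.
  + by framed.
  + by framed.
  + by framed.
  + by framed.
  + by framed.
  + by framed.
  + by framed.
  + by framed.
  + by framed.
  move=> s5 F5 [m' [s5_27 /andP[m'_gt0 le_m'] out' lower']].
  exists m'; split=> //.
  + by rewrite m'_gt0; case/andP: le_m => _; apply: leq_trans.
  + rewrite -[output_square (iset s5 _ _ _)]/(output_square s5).
    case: out' => [[-> ->]|[i [j [le_k ->]]]]; last by right; exists t, i, j.
    case: out => [->|[u [i [j [lt_u le_k ->]]]]]; first by left.
    by right; exists u, i, j; split=> //; apply: ltnW.
  + move=> u i j len; rewrite ltnS leq_eqVlt => /orP[/eqP ->|lt_u]; first exact: lower'.
    by move=> /(lower _ _ _ _ lt_u); apply: leq_trans.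
by move=> s4 _ [m [_ _ out lower]]; exists m.
Qed.

End SmallestBlock.

(** * Quality of the recorded square and estimates for the time bound *)

Section Approximation.
Variable R : realType.
Local Open Scope ring_scope.
Implicit Types (pts : seq (R * R)) (eps : R).

Lemma resolution_gt0 eps : (0 < resolution eps)%N.
Proof. by rewrite /resolution; case: ifP. Qed.

Lemma resolution_inv eps : 0 < eps -> (resolution eps)%:R^-1 <= eps.
Proof.
move=> eps_gt0; rewrite /resolution; case: ifP => [_|/negbT].
  by rewrite invf_ple ?posrE ?ltr0n // -[X in (X <= _)%R]div1r ltW ?truncnS_gt.
by rewrite -ltNge invr1 => /ltW.
Qed.

(** For [eps <= 1] the resolution is at most [1 / eps + 1 <= 2 / eps]; the summand 1 covers
    [eps > 1]. *)
Lemma resolution_sqr eps : 0 < eps ->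
  (resolution eps)%:R ^+ 2 <= 1 + 4 / eps ^+ 2.
Proof.
move=> eps_gt0; rewrite /resolution; case: ifP => [eps_le1|_]; last first.
  by rewrite expr1n lerDl divr_ge0 ?exprn_ge0 // ltW.
have q_ge1 : 1 <= 1 / eps by rewrite div1r invf_ge1.
have le_N : (Num.truncn (1 / eps)).+1%:R <= 2 * (1 / eps).
  have : (Num.truncn (1 / eps))%:R <= 1 / eps.
    by rewrite truncn_le; apply: le_trans q_ge1.
  by rewrite -natr1; lra.
have -> : 4 / eps ^+ 2 = (2 * (1 / eps)) ^+ 2.
  by rewrite exprMn expr_div_n expr1n mulrA mulr1; congr (_ / _); rewrite -natrX.
rewrite (le_trans (lerXn2r 2 _ _ le_N)) ?nnegrE ?ler0n ?lerDr //.
by rewrite mulr_ge0 // (le_trans _ q_ge1).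
Qed.

Lemma block_approx pts k X Y eps r0 m Q : uniq pts -> (1 < k)%N -> 0 < eps ->
  net_for k [seq p.1 | p <- pts] X -> net_for k [seq p.2 | p <- pts] Y ->
  is_min_radius X Y pts k (size X * size Y) r0 ->
  let N := resolution eps in let delta := r0 / (2 * N)%N%:R in
  (m = 8 * N + 1 \/ exists t i j, [/\ t < size X * size Y,
     k <= block (vertex_cells X Y pts r0 delta t) i j m &
     Q = block_square (box (vert X Y t) r0) delta i j m])%N ->
  (forall t i j len, t < size X * size Y ->
     k <= block (vertex_cells X Y pts r0 delta t) i j len -> m <= len)%N ->
  0 < r0 -> approx_smallest pts k eps Q.
Proof.
move=> uniq_pts k_gt1 eps_gt0 netX netY [[t0 lt_t0 k_r0] min_r0] N delta out lower r0_gt0.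
have k_gt0 := ltnW k_gt1.
have N_gt0 : 0 < N%:R :> R by rewrite ltr0n resolution_gt0.
have NE : (2 * N)%N%:R = 2 * N%:R :> R by rewrite natrM.
have delta_gt0 : 0 < delta by rewrite divr_gt0 // NE mulr_gt0.
have [Qmin [kQmin minQ]] := smallest_k_enclosing_exists k_gt0 (kth_ball k_gt0 k_r0).
have le_2r0 : side Qmin <= 2 * r0 by apply: minQ (kth_ball k_gt0 k_r0).
have [a [b [lt_a lt_b Qab]]] := enclosed_vertex netX netY kQmin.
pose t := (a * size Y + b)%N.
have vt : vert X Y t = (nth 0 X a, nth 0 Y b).
  rewrite /vert /t divnMDl ?modnMDl ?divn_small ?modn_small ?addn0 //.
  exact: leq_ltn_trans lt_b.
have lt_t : (t < size X * size Y)%N.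
  rewrite /t -ltn_subRL -mulnBl; apply: leq_trans lt_b _.
  by rewrite leq_pmull // subn_gt0.
rewrite -vt in Qab.
have [rho k_rho le_rho] := min_r0 t lt_t.
have le_r0 : r0 <= side Qmin := le_trans le_rho (kth_dist_le kQmin Qab k_rho).
have [i [j le_k]] := enclosed_block r0_gt0 delta_gt0 Qab kQmin le_2r0.
have := lower _ _ _ _ lt_t le_k.
set q := Num.truncn _ => le_m.
have q_le : q%:R <= side Qmin / delta.
  by rewrite truncn_le divr_ge0 ?(ltW delta_gt0) // (le_trans (ltW r0_gt0)).
(* The minimal side is at most [2 * r0], which is [4 * N] cells. *)
have q_le4 : (q <= 4 * N)%N.
  rewrite -(ler_nat R) (le_trans q_le) // ler_pdivrMr // /delta NE natrM.
  have -> : 4%:R * N%:R * (r0 / (2 * N%:R)) = 2 * r0.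
    by field; rewrite gt_eqF.
  exact: le_2r0.
(* [m <= 4 * N + 2] is below the initial size, so a square has been recorded. *)
have lt_mM : (m < 8 * N + 1)%N.
  have aux (u v w : nat) : (0 < w -> u <= v.+2 -> v <= 4 * w -> u < 8 * w + 1)%N.
    by clear; lia.
  exact: aux (resolution_gt0 eps) le_m q_le4.
case: out => [mM|[u [i' [j' [lt_u le_k' ->]]]]]; first by rewrite mM ltnn in lt_mM.
split; first exact: block_k_enclosing le_k'.
exists Qmin => //=.
have : m%:R <= side Qmin / delta + 2.
  have : m%:R <= q.+2%:R :> R by rewrite ler_nat.
  by rewrite -addn2 natrD; lra.
rewrite -(ler_pM2r delta_gt0) mulrDl divfK ?gt_eqF // => le_side.
apply: le_trans le_side _; rewrite [leRHS]mulrDl mul1r lerD2l.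
(* The excess of two cells is [r0 / N], at most [eps] times the minimal side because [r0] does not
   exceed that side. *)
have -> : 2 * delta = N%:R^-1 * r0.
  by rewrite /delta NE; field; rewrite gt_eqF.
by rewrite ler_pM ?invr_ge0 ?ler0n ?(ltW r0_gt0) // resolution_inv.
Qed.

(** From [1 - 1 / x <= ln x] the logarithmic term is at least [x ^ 2 - x]. For [x >= 2] this is at
    least half of [x ^ 2]. For smaller [x] it is at least [- 1 / 4], while [x ^ 2 < 4 <= 4 * n], so
    the term [n] suffices. *)
Lemma ler_add_sqr_ln (n x : R) : 1 <= n -> 0 < x ->
  n + x ^+ 2 <= 10 * (n + x ^+ 2 * ln x).
Proof.
move=> n_ge1 x_gt0.
have ln_ge : 1 - x^-1 <= ln x.
  have xV_gt0 : 0 < x^-1 by rewrite invr_gt0.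
  have := @le_ln1Dx R (x^-1 - 1).
  rewrite (addrC 1) subrK lnV ?posrE // => le_ln.
  by have := le_ln ltac:(lra); lra.
have sq_ln : x ^+ 2 * (1 - x^-1) <= x ^+ 2 * ln x by rewrite ler_pM2l ?exprn_gt0.
have sqE : x ^+ 2 * (1 - x^-1) = x ^+ 2 - x.
  by rewrite mulrBr mulr1 expr2 -mulrA divff ?mulr1 ?gt_eqF.
rewrite sqE in sq_ln.
have [x_ge2|x_lt2] := leP 2 x.
  by have : 0 <= (x - 2) * x by [rewrite mulr_ge0 ?subr_ge0 // ltW]; nra.
have [x_ge1|x_lt1] := leP 1 x; nra.
Qed.

End Approximation.

(** * The algorithm *)

Definition first_point :=
  Seq (RSet 3 (num 0) (RGet 0 (num 0)))
 (Seq (RSet 3 (num 1) (RGet 1 (num 0)))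
      (RSet 3 (num 2) (ROfInt (num 0)))).

Definition approx_program :=
  If (BIntLe (scalar 1) (num 1)) first_point
 (Seq (coordinate_net false)
 (Seq (coordinate_net true)
 (Seq min_radius smallest_block))).

Section Program.
Variables (R : realType) (W : nat).
Implicit Types (s : store R) (pts : seq (R * R)).

Lemma first_point_approx pts (eps : R) Q : (0 < eps)%R -> 0 < size pts ->
  Q = Square ((nth 0%R pts 0).1, (nth 0%R pts 0).2) 0%R ->
  approx_smallest pts 1 eps Q.
Proof.
move=> eps_gt0 n_gt0 ->; set p := nth 0%R pts 0.
have kQ : k_enclosing pts 1 (Square (p.1, p.2) 0%R).
  split=> //=; rewrite -has_count; apply/hasP; exists p; first exact: mem_nth.
  by rewrite /encloses /= !addr0 !lexx.
split=> //; exists (Square (p.1, p.2) 0%R); last by rewrite /= mulr0.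
by split=> // Q' [].
Qed.

(** [10 * K.+1] bounds the size of each net, and its square the number of vertices; [100 * 100]
    covers the steps per unit of [n + N ^ 2]. *)
Definition rate K := 100 * (100 * (10 * K.+1) ^ 2).

Lemma runs_approx_program s pts k (eps : R) K :
  let N := resolution eps in
  uniq pts -> 0 < k <= size pts -> (0 < eps)%R -> size pts <= K * k ->
  rate K * (size pts + N ^ 2) <= W ->
  input_store pts k eps s ->
  runs W approx_program s (rate K * (size pts + N ^ 2))
    (fun s' => approx_smallest pts k eps (output_square s')).
Proof.
move=> N uniq_pts /andP[k_gt0 le_k] eps_gt0 le_nK le_W [s0 s1 sx sy s2].
have N_gt0 : 0 < N := resolution_gt0 eps.
have n_gt0 : 0 < size pts by apply: leq_trans le_k.
have hx : holds (reals s 0) [seq p.1 | p <- pts].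
  by move=> i; rewrite size_map => lt_i; rewrite sx // (nth_map 0%R).
have hy : holds (reals s 1) [seq p.2 | p <- pts].
  by move=> i; rewrite size_map => lt_i; rewrite sy // (nth_map 0%R).
set n := size pts in s0 n_gt0 le_nK le_k le_W *.
set G := 10 * K.+1.
have G_ge10 : 10 <= G by rewrite leq_pmulr.
(* A common majorant of all terms in the time and word bounds; once its body is forgotten, the
   remaining comparisons are linear. *)
pose S := G ^ 2 * (n + N ^ 2).
have rateE : rate K * (n + N ^ 2) = 100 * (100 * S) by rewrite /rate -/G /S; lia.
rewrite rateE in le_W *.
have G_gt0 : 0 < G by apply: leq_trans G_ge10.
have N2_gt0 : 0 < N ^ 2 by rewrite expn_gt0 N_gt0.
have G_S : 10 * G <= S.
  by rewrite /S -mulnn -mulnA leq_mul // (leq_trans (_ : G <= G * n)) ?leq_pmulr // leq_mul2l leq_addr orbT.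
have Gn_S : 10 * (G * n) <= S.
  by rewrite /S -mulnn -mulnA leq_mul // leq_mul2l leq_addr orbT.
have GGn_S : G ^ 2 * n <= S by rewrite leq_mul2l leq_addr orbT.
have GGN_S : G ^ 2 * N ^ 2 <= S by rewrite leq_mul2l leq_addl orbT.
have GG_S : G ^ 2 <= S.
  by rewrite (leq_trans (_ : _ <= G ^ 2 * n)) // leq_pmulr.
have n_S : n <= S by rewrite (leq_trans _ GGn_S) // leq_pmull // expn_gt0 G_gt0.
have N_S : N ^ 2 <= S by rewrite (leq_trans _ GGN_S) // leq_pmull // expn_gt0 G_gt0.
have S_gt0 : 0 < S by apply: leq_trans n_S.
clearbody S.
have netG : net_size n k <= G.
  rewrite /net_size leq_mul2l ltnS /=; rewrite -ltnS ltn_divLR //.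
  by apply: leq_ltn_trans le_nK _; rewrite ltn_mul2r k_gt0 /=.
have [k1|k_gt1] := leqP k 1.
  have {k1}k1 : k = 1 by apply/eqP; rewrite eqn_leq k1.
  apply: (@runs_time _ _ _ _ 4); last by lia.
  apply: runs_if; first by rewrite /= s1.
  rewrite /= s1 k1 /=; apply: runs_straight; reads; do 3 (split=> //).
  apply: first_point_approx => //.
  by rewrite /output_square; reads; rewrite sx // sy.
set M := 8 * N + 1.
have MM : M.+1 * M.+1 <= 100 * N ^ 2 by rewrite /M; nia.
have GW : 2 * net_size n k * n.+1 <= W.
  have : 2 * net_size n k * n.+1 <= 2 * G * n.+1 by rewrite leq_mul2r leq_mul2l netG orbT.
  by lia.
apply: (@runs_time _ _ _ _ ((n * (10 * G + 50) + 10) + ((n * (10 * G + 50) + 10) +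
  ((G ^ 2 * (n * 2315 + 20) + 3) +
   (G ^ 2 * (100 * N ^ 2 * 28 + n * 5 + 15) + 11)))).+1); last by lia.
apply: runs_if; first by rewrite /= s1.
rewrite /= s1 /= leqNgt k_gt1 /=.
have time_net : n * (10 * net_size n k + 50) + 10 <= n * (10 * G + 50) + 10.
  by rewrite leq_add2r leq_mul2l leq_add2r leq_mul2l netG !orbT.
apply: (runs_seq (Q1 := fun s' => exists X, [/\ ints s' 20 0 = Posz (size X),
    holds (reals s' 7) X, size X <= G & net_for k [seq p.1 | p <- pts] X])).
  have := @runs_coordinate_net R W s false [seq p.1 | p <- pts] k.
  rewrite size_map -/n => /(_ s0 s1 hx); rewrite k_gt0 le_k => /(_ isT GW) r.
  apply: runs_weaken r time_net _ => s' _ [X [? ? le_X ?]]; exists X; split=> //.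
  exact: leq_trans netG.
move=> s3 F3 [X [s3_20 h7 le_X netX]].
apply: (runs_seq (Q1 := fun s' => exists Y, [/\ ints s' 21 0 = Posz (size Y),
    holds (reals s' 8) Y, size Y <= G & net_for k [seq p.2 | p <- pts] Y])).
  have := @runs_coordinate_net R W s3 true [seq p.2 | p <- pts] k.
  rewrite size_map -/n => r.
  apply: runs_weaken (r _ _ _ _ GW) time_net _; rewrite ?k_gt0 //.
  - by framed.
  - by framed.
  - by framed.
  move=> s' _ [Y [? ? le_Y ?]]; exists Y; split=> //.
  exact: leq_trans netG.
move=> s4 F4 [Y [s4_21 h8 le_Y netY]].
have TG : size X * size Y <= G ^ 2 by rewrite -mulnn leq_mul.
have X_gt0 : 0 < size X.
  have /hasP[x xX _] : has predT X by apply: netX; rewrite // count_predT size_map.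
  by case: (X) xX.
have Y_gt0 : 0 < size Y.
  have /hasP[y yY _] : has predT Y by apply: netY; rewrite // count_predT size_map.
  by case: (Y) yY.
have TW : size X * size Y <= W by lia.
apply: (runs_seq (Q1 := fun s' => ints s' 24 0 = Posz (size X * size Y) /\
    is_min_radius X Y pts k (size X * size Y) (reals s' 12 0))).
  apply: runs_time.
    apply: (runs_min_radius (pts := pts) (k := k) (X := X) (Y := Y)) => //.
    - by framed.
    - by framed.
    - by rewrite k_gt0.
    - by rewrite -/n; lia.
    - by framed.
    - by framed.
    - by framed.
    - by framed.
    by rewrite muln_gt0 X_gt0.
  by rewrite leq_add2r leq_mul2r TG orbT.
move=> s5 F5 [s5_24 min_r]; set r0 := reals s5 12 0 in min_r.
have r0_gt0 : (0 < r0)%R.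
  have [[t _ k_r0] _] := min_r.
  have := k_enclosing_side_gt0 uniq_pts k_gt1 (kth_ball k_gt0 k_r0).
  by rewrite /= pmulr_rgt0.
apply: runs_weaken (runs_smallest_block (pts := pts) (k := k) (X := X) (Y := Y)
  (eps := eps) (r0 := r0) _ _ _ _ _ _ _ _ _ _ _ _ _ _ _ _) _ _ => //.
- by framed.
- by framed.
- by framed.
- by framed.
- by framed.
- by framed.
- by framed.
- by framed.
- by apply: leq_trans MM _; lia.
- by rewrite -/n; lia.
- rewrite leq_add2r; apply: leq_mul => //.
  by rewrite leq_add2r leq_add2r leq_mul2r MM orbT.
move=> s6 _ [m out lower].
exact: (block_approx uniq_pts k_gt1 eps_gt0 netX netY min_r out lower r0_gt0).
Qed.

End Program.

Local Open Scope ring_scope.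

Theorem theorem7 (R : realType) :
  exists prog : cmd,
  forall c : R, 0 < c ->
  exists C : R, 0 < C /\
  forall (pts : seq (R * R)) (k : nat) (eps : R),
    uniq pts ->
    (0 < k <= size pts)%N ->
    c * (size pts)%:R <= k%:R ->
    0 < eps ->
  forall (W : nat) (s : store R),
    C * ((size pts)%:R + 1 / eps ^+ 2) <= W%:R ->
    input_store pts k eps s ->
  exists (t : nat) (s' : store R),
    [/\ exec W prog s t s',
        approx_smallest pts k eps (output_square s')
      & t%:R <= C * ((size pts)%:R + 1 / eps ^+ 2 * ln (1 / eps))].
Proof.
exists approx_program => c c_gt0.
pose K := (Num.truncn (1 / c)).+1.
(* Here 40 is used: a factor 4 from [n + N ^ 2 <= 4 * (n + 1 / eps ^ 2)] and a factor 10 from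
   [ler_add_sqr_ln]. *)
exists (50 * (rate K)%:R); split.
  by rewrite mulr_gt0 // ltr0n /rate muln_gt0 expn_gt0 muln_gt0.
move=> pts k eps uniq_pts le_k ck eps_gt0 W s CW inp.
set n := size pts in le_k ck CW *.
set A : R := (rate K)%:R in CW *.
have A_ge0 : 0 <= A by apply: ler0n.
have n_ge1 : 1 <= n%:R :> R by rewrite ler1n; case/andP: le_k => /leq_trans; apply.
have q_ge0 : 0 <= 1 / eps ^+ 2 by rewrite divr_ge0 ?exprn_ge0 // ltW.
have le_nK : (n <= K * k)%N.
  rewrite -(ler_nat R) natrM.
  have le_nk : n%:R <= 1 / c * k%:R.
    by rewrite mulrAC mul1r ler_pdivlMr // mulrC.
  apply: le_trans le_nk _; rewrite ler_wpM2r ?ler0n // ltW //.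
  exact: truncnS_gt.
have sizeE : (rate K * (n + resolution eps ^ 2))%N%:R <=
    4 * A * (n%:R + 1 / eps ^+ 2).
  rewrite natrM natrD natrX -/A -mulrA mulrCA ler_wpM2l //.
  have := resolution_sqr eps_gt0; move: q_ge0; rewrite -(mul1r (_ ^-1)) mulrA.
  lra.
have le_W : (rate K * (n + resolution eps ^ 2) <= W)%N.
  rewrite -(ler_nat R); apply: le_trans sizeE (le_trans _ CW).
  by rewrite ler_wpM2r ?addr_ge0 ?ler0n // ler_wpM2r // ler_nat.
have [t [s' [ex le_t approx]]] :=
  runs_approx_program uniq_pts le_k eps_gt0 le_nK le_W inp.
exists t, s'; split=> //.
have : t%:R <= 4 * A * (n%:R + 1 / eps ^+ 2).
  by apply: le_trans sizeE; rewrite ler_nat.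
have x_gt0 : 0 < 1 / eps by rewrite divr_gt0.
have := ler_add_sqr_ln n_ge1 x_gt0; rewrite expr_div_n expr1n => bound le_t'.
apply: le_trans le_t' _.
apply: le_trans (_ : 4 * A * (10 * (n%:R + 1 / eps ^+ 2 * ln (1 / eps))) <= _).
  by rewrite ler_wpM2l // mulr_ge0.
(* As the logarithm may be negative, nonnegativity of the sum is read off [bound]. *)
have sum_ge0 : 0 <= n%:R + 1 / eps ^+ 2 * ln (1 / eps).
  by rewrite -(pmulr_rge0 _ (ltr0n _ 10)) (le_trans _ bound) // addr_ge0 // ler0n.
have -> : 4 * A * (10 * (n%:R + 1 / eps ^+ 2 * ln (1 / eps))) =
          40 * A * (n%:R + 1 / eps ^+ 2 * ln (1 / eps)) by ring.
by rewrite ler_wpM2r // ler_wpM2r // ler_nat.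
Qed.
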